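(* Let $\mathcal{X} \subset \mathbb{R}^d$ be a set of $n$ points and let $\mathbf{q} \in \mathbb{R}^d$ with $\|\mathbf{q}\| = 1$. Assume $\mathbf{x} \in \mathcal{X}$ is the top-1 maximum inner product point for $\mathbf{q}$, i.e. $\mathbf{x} = \arg\max_{\mathbf{z} \in \mathcal{X}} \mathbf{z}^\top \mathbf{q}$. For every $\mathbf{y} \in \mathcal{X} \setminus \{\mathbf{x}\}$ let $$\alpha_{\mathbf{y}} = \frac{\mathbf{x}^\top \mathbf{q} - \mathbf{y}^\top \mathbf{q}}{\sqrt{\|\mathbf{x}\|^2 - (\mathbf{x}^\top \mathbf{q})^2} + \sqrt{\|\mathbf{y}\|^2 - (\mathbf{y}^\top \mathbf{q})^2}}.$$ Let $s_0$ be a fixed positive integer and $c > 1$ a constant, and assume $\alpha_{\mathbf{y}}^2 > c/s_0$ for all $\mathbf{y} \in \mathcal{X} \setminus \{\mathbf{x}\}$. Let $D = n^{1/c}$, let $\mathbf{r}_1, \dots, \mathbf{r}_D \in \mathbb{R}^d$ be independent random vectors with i.i.d. $N(0,1)$ coordinates, and for a point $\mathbf{z} \in \mathbb{R}^d$ let $Z_{[r]}$ denote the concomitant of the $r$-th order statistic of the query signature, as defined in the context. Then, for sufficiently large $n$, $$\Pr\left[\sum_{r=1}^{s_0}\left(X_{[r]} - X_{[D-r+1]}\right) \geq \sum_{r=1}^{s_0}\left(Y_{[r]} - Y_{[D-r+1]}\right) \text{ for all } \mathbf{y} \in \mathcal{X}\setminus\{\mathbf{x}\}\right] \geq 1 -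 1/n,$$ where $X_{[r]}$ and $Y_{[r]}$ are the concomitants for $\mathbf{x}$ and $\mathbf{y}$ respectively.
   Context: Query signature and concomitants: given random vectors $\mathbf{r}_1, \dots, \mathbf{r}_D$, set $Q_i = \mathbf{q}^\top \mathbf{r}_i$ for $i = 1, \dots, D$, and sort these values in descending order, $Q_{(1)} \geq Q_{(2)} \geq \dots \geq Q_{(D)}$, where $Q_{(r)}$ is the $r$-th order statistic (so $Q_{(1)}$ is the maximum and $Q_{(D)}$ the minimum). Let $i_r$ be the index with $Q_{i_r} = Q_{(r)}$. For a point $\mathbf{z} \in \mathbb{R}^d$, with $Z_i = \mathbf{z}^\top \mathbf{r}_i$, the concomitant of the $r$-th order statistic is $Z_{[r]} = Z_{i_r} = \mathbf{z}^\top \mathbf{r}_{i_r}$, i.e. the projected value of $\mathbf{z}$ on the random direction at which the query's projection attains its $r$-th largest value. Thus $X_{[r]} = \mathbf{x}^\top \mathbf{r}_{i_r}$ and $Y_{[r]} = \mathbf{y}^\top \mathbf{r}_{i_r}$. The result is stated in the paper in an asymptotic regime (''sufficiently large $n$'', hence sufficiently large $D$). *)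

(* Defs.v *)
From HB Require Import structures.
From mathcomp Require Import all_boot all_order all_algebra finmap.
From mathcomp Require Import all_classical all_reals all_analysis.

Set Implicit Arguments.
Unset Strict Implicit.
Unset Printing Implicit Defensive.

Import Order.TTheory GRing.Theory Num.Theory.
Import numFieldNormedType.Exports.

Local Open Scope classical_set_scope.
Local Open Scope ring_scope.

Section Euclidean.
Context {R : realType} {d : nat}.
Implicit Types u v q x y : 'cV[R]_d.

Definition dot u v : R := (u^T *m v) 0 0.

(* The library norm `|u| on matrices is the sup norm, hence this one. *)
Definition enorm u : R := Num.sqrt (dot u u).

Definition alpha q x y : R :=
  (dot x q - dot y q) /
  (Num.sqrt (enorm x ^+ 2 - dot x q ^+ 2)
   + Num.sqrt (enorm y ^+ 2 - dot y q ^+ 2)).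

End Euclidean.

Section Concomitants.
Context {R : realType} {D : nat}.
Implicit Types Q Z : 'I_D -> R.

(* The sequence i_1, ..., i_D with Q i_1 >= ... >= Q i_D; the sort is stable,
   so ties are broken by increasing index. *)
Definition desc_order Q : seq 'I_D :=
  sort (fun i j => Q j <= Q i) (enum 'I_D).

(* Z_[r] = Z i_r; ranks r start from 1, positions in a sequence from 0. *)
Definition concomitant Q Z (r : nat) : R :=
  nth 0 [seq Z i | i <- desc_order Q] r.-1.

End Concomitants.

(* The sum over r = 1, ..., s0 of Z_[r] - Z_[D-r+1], where Q_i = q^T r_i and
   Z_i = z^T r_i. *)
Definition ceos_score {R : realType} {d D : nat} (s0 : nat)
    (rv : 'I_D -> 'cV[R]_d) (q z : 'cV[R]_d) : R :=
  let conc := concomitant (fun i => dot q (rv i)) (fun i => dot z (rv i)) in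
  \sum_(1 <= r < s0.+1) (conc r - conc (D - r + 1)%N).

Section Probability.
Context {R : realType} {disp : measure_display} {T : measurableType disp}.
Variable P : probability T R.

Definition mutually_independent {I : finType} (X : I -> {RV P >-> R}) : Prop :=
  forall (J : {set I}) (B : I -> set R), (forall i, measurable (B i)) ->
  P (\bigcap_(i in [set` J]) (X i @^-1` B i)) =
  (\prod_(i in J) P (X i @^-1` B i))%E.

Definition standard_normal (X : {RV P >-> R}) : Prop :=
  forall B : set R, measurable B -> distribution P X B = normal_prob 0 1 B.

(* g i j is the j-th coordinate of the i-th random vector: the vectors are
   independent with independent coordinates exactly when the whole family of
   coordinates is mutually independent. *)
Definition iid_gaussian_vectors {D d : nat}
    (g : 'I_D -> 'I_d -> {RV P >-> R}) : Prop :=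
  mutually_independent (fun ij : 'I_D * 'I_d => g ij.1 ij.2) /\
  forall i j, standard_normal (g i j).

Definition random_vectors {D d : nat} (g : 'I_D -> 'I_d -> {RV P >-> R})
    (w : T) (i : 'I_D) : 'cV[R]_d := \col_j g i j w.

End Probability.

(* Main.v *)
Require Import Defs.
From HB Require Import structures.
From mathcomp Require Import all_boot all_order all_algebra finmap.
From mathcomp Require Import all_classical all_reals all_analysis.
From mathcomp Require Import measurable_realfun ring lra zify.

Set Implicit Arguments.
Unset Strict Implicit.
Unset Printing Implicit Defensive.

Import Order.TTheory GRing.Theory Num.Theory.
Import numFieldNormedType.Exports.

Local Open Scope classical_set_scope.
Local Open Scope ring_scope.

(* Fix an outcome and let v be the sum of the r_i over the s0 top ranks minus
   the sum over the s0 bottom ranks of the query signature, so that the score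
   of z is z . v.  Splitting z . v along q and its orthogonal complement, the
   gap condition makes x beat every y simultaneously as soon as
   |v_perp| <= sqrt (c / s0) (q . v).  No union bound over the n points is
   needed; since d is fixed, only one bad event must have probability <= 1/n.

   With a^2 = (3/2) (ln n) / c, so that D is about exp (2 a^2 / 3), two facts
   suffice.
   - q . v >= 2 s0 a.  One projection q . r_i exceeds a with probability
     exp (- a^2 / 2 - O(a)), much larger than 1 / D, so all of s0 disjoint
     blocks of about D / s0 indices contain such an i, except with a probability
     smaller than any power of 1 / n; likewise for - q.
   - |v_perp| <= 2 a sqrt (c s0).  For u orthogonal to q, shifting each r_i by a
     multiple of u does not change the ranks, so by the Cameron-Martin formula
     u . v has the exponential moments of a Gaussian of variance 2 s0 |u|^2,
     although the ranks are random.  Chernoff's bound over a finite net of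
     directions u gives a probability O(n^(-5/4)). *)

(** * Densities *)

Section Density.
Context {disp : measure_display} {T : measurableType disp} {R : realType}.
Local Open Scope ereal_scope.
Import HBNNSimple.

(* With [W = 1] this is change of variables; with [Y] the identity it is
   integration against the measure of density [W]. *)
Lemma ge0_integral_law (mu : {measure set T -> \bar R})
    (nu : {measure set R -> \bar R}) (Y : {mfun T >-> R}) (W : T -> R)
    (f : R -> R) :
  measurable_fun setT W -> (forall w, 0 <= W w)%R ->
  measurable_fun setT f -> (forall x, 0 <= f x)%R ->
  (forall B, measurable B -> \int[mu]_(w in Y @^-1` B) (W w)%:E = nu B) ->
  \int[mu]_w (f (Y w) * W w)%:E = \int[nu]_x (f x)%:E.
Proof.
move=> mW W0 mf f0 law.
have mEf : measurable_fun [set: R] (fun x : R => (f x)%:E).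
  exact/measurable_EFinP.
(* Monotone convergence along the simple functions [h n], which increase to [f], and linearity
   reduce the claim to indicators, where it is [law]. *)
pose h := nnsfun_approx measurableT mEf.
have hf x : (EFin \o h ^~ x) @ \oo --> (f x)%:E.
  by apply: (cvg_nnsfun_approx measurableT mEf) => // y _; rewrite lee_fin.
have mYB (B : set R) : measurable B -> measurable (Y @^-1` B).
  by move=> mB; rewrite -[X in measurable X]setTI; exact: measurable_funP.
have -> : \int[nu]_x (f x)%:E = limn (fun n => \int[nu]_x (h n x)%:E).
  under eq_integral => x _ do rewrite -(cvg_lim _ (hf x))//.
  apply: monotone_convergence => //.
  - by move=> n; exact/measurable_EFinP.
  - by move=> n x _; rewrite lee_fin.
  - by move=> x _ m n mn; rewrite lee_fin; exact/lefP/nd_nnsfun_approx.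
have -> : \int[mu]_w (f (Y w) * W w)%:E =
    limn (fun n => \int[mu]_w (h n (Y w) * W w)%:E).
  have hW w : (fun n => (h n (Y w) * W w)%:E) @ \oo --> (f (Y w) * W w)%:E.
    rewrite EFinM; under eq_fun do rewrite EFinM.
    by apply: cvgeZr => //; exact: hf.
  under eq_integral => w _ do rewrite -(cvg_lim _ (hW w))//.
  apply: monotone_convergence => //.
  - move=> n; apply/measurable_EFinP/measurable_funM => //.
    exact: measurableT_comp.
  - by move=> n w _; rewrite lee_fin mulr_ge0.
  - move=> w _ m n mn; rewrite lee_fin ler_wpM2r//.
    exact/lefP/nd_nnsfun_approx.
congr (limn _); apply/funext => n.
have -> : \int[nu]_x (h n x)%:E =
    \int[nu]_x (\sum_(y \in range (h n)) (y * \1_(h n @^-1` [set y]) x)%:E).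
  by apply: eq_integral => x _; rewrite fimfunE -fsumEFin.
rewrite ge0_integral_fsum//; last 2 first.
- by move=> y; apply/measurable_EFinP; apply: measurable_funM.
- by move=> y x _; exact: nnfun_muleindic_ge0.
have -> : \int[mu]_w (h n (Y w) * W w)%:E = \int[mu]_w
    (\sum_(y \in range (h n)) (y * \1_(h n @^-1` [set y]) (Y w) * W w)%:E).
  apply: eq_integral => w _; rewrite fimfunE fsumEFin//; congr EFin.
  by rewrite !fsbig_finite//= mulr_suml.
rewrite ge0_integral_fsum//; last 2 first.
- move=> y; apply/measurable_EFinP; apply: measurable_funM => //.
  apply: measurable_funM => //.
  apply: (@measurableT_comp _ _ _ _ _ _
    (fun x => \1_(h n @^-1` [set y]) x : R) _ Y) => //.
  exact: measurable_indic.
- move=> y w _; rewrite lee_fin mulr_ge0//.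
  by have := nnfun_muleindic_ge0 (h n) y (Y w); rewrite -lee_fin.
apply: eq_fsbigr => y /[!inE] -[x _ <-{y}].
have hy0 : (0 <= h n x)%R by [].
set y := h n x.
under [LHS]eq_integral => w _ do rewrite -mulrA EFinM.
rewrite ge0_integralZl//; last 2 first.
- apply/measurable_EFinP; apply: measurable_funM => //.
  apply: (@measurableT_comp _ _ _ _ _ _
    (fun x => \1_(h n @^-1` [set y]) x : R) _ Y) => //.
  exact: measurable_indic.
- by move=> w _; rewrite lee_fin mulr_ge0.
under [RHS]eq_integral => w _ do rewrite EFinM.
rewrite ge0_integralZl//; last exact/measurable_EFinP.
congr (_ * _).
rewrite integral_indic// setIT -law//.
rewrite [RHS]integral_mkcond; apply: eq_integral => w _.
have memY : (w \in Y @^-1` (h n @^-1` [set y])) = (Y w \in h n @^-1` [set y]).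
  by apply/idP/idP; rewrite !inE.
by rewrite patchE memY indicE; case: ifP; rewrite ?mul1r ?mul0r.
Qed.

End Density.

Section Mdensity.
Context {disp : measure_display} {T : measurableType disp} {R : realType}.
Variables (mu : {measure set T -> \bar R}) (W : T -> R).
Hypotheses (mW : measurable_fun setT W) (W0 : forall w, 0 <= W w).
Local Open Scope ereal_scope.

(** Made into a measure so that uniqueness of measures applies to the tilted law in
    [cameron_martin]. *)
Definition mdensity (A : set T) : \bar R := \int[mu]_(w in A) (W w)%:E.

Let mdensity0 : mdensity set0 = 0.
Proof. exact: integral_set0. Qed.

Let mdensity_ge0 A : 0 <= mdensity A.
Proof. by apply: integral_ge0 => w _; rewrite lee_fin. Qed.

Let mdensity_sigma_additive : semi_sigma_additive mdensity.
Proof.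
move=> F mF tF mUF; rewrite /mdensity ge0_integral_bigcup//=; last 2 first.
- by apply: measurable_funTS; exact/measurable_EFinP.
- by move=> w _; rewrite lee_fin.
by apply: is_cvg_ereal_nneg_natsum_cond => n _ _; exact: mdensity_ge0.
Qed.

HB.instance Definition _ := isMeasure.Build _ _ _ mdensity
  mdensity0 mdensity_ge0 mdensity_sigma_additive.

Definition mdensity_measure : {measure set T -> \bar R} := mdensity.

End Mdensity.

(** * One-dimensional Gaussian tilting *)

Section NormalTilt.
Context {R : realType}.
Local Open Scope ereal_scope.
Local Notation leb := (@lebesgue_measure R).

Lemma measurable_shift (b : R) (B : set R) :
  measurable B -> measurable ((fun x : R => (x + b)%R) @^-1` B).
Proof.
move=> mB; rewrite -[X in measurable X]setTI.
by apply: measurable_funD => //; exact: measurable_cst.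
Qed.

Lemma lebesgue_measure_shift (b : R) (A : set R) : measurable A ->
  leb ((fun x : R => (x + b)%R) @^-1` A) = leb A.
Proof.
have ms : measurable_fun setT ((fun x => x + b)%R : R -> measurableTypeR R).
  by apply: measurable_funD => //; exact: measurable_cst.
move=> mA; rewrite -[LHS]/(pushforward leb
  ((fun x => x + b)%R : measurableTypeR R -> measurableTypeR R) A).
apply/esym/lebesgue_measure_unique => //= _ [[u v]] _ <-.
rewrite /pushforward/=.
have -> : (fun x : R => (x + b)%R) @^-1` `]u, v]%classic =
          `](u - b)%R, (v - b)%R]%classic.
  by apply/seteqP; split => x /=; rewrite !in_itv/= ltrBlDr lerBrDr.
rewrite !lebesgue_measure_itv/= !lte_fin ltrD2r.
by case: ifPn => // _; rewrite -!EFinD; congr EFin; ring.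
Qed.

(** Completing the square turns the tilted density into the normal density centred at [b];
    translation invariance of Lebesgue measure then moves the shift onto [B]. *)
Lemma normal_tilt (b : R) (B : set R) : measurable B ->
  \int[leb]_(x in B) (expR (b * x - b ^+ 2 / 2) * normal_pdf 0 1 x)%:E =
  normal_prob 0 1 ((fun x : R => (x + b)%R) @^-1` B).
Proof.
move=> mB.
have E x : (expR (b * x - b ^+ 2 / 2) * normal_pdf 0 1 x =
    normal_pdf 0 1 (x - b))%R.
  rewrite !normal_pdfE ?oner_neq0// mulrCA; congr (_ * _)%R.
  rewrite /normal_fun -expRD !subr0 !expr1n !mulNr; congr expR.
  by field.
have ms : measurable_fun setT ((fun x => x + b)%R :
    measurableTypeR R -> measurableTypeR R).
  by apply: measurable_funD => //; exact: measurable_cst.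
have mpdf : measurable_fun setT (fun x : R => (normal_pdf 0 1 (x - b))%:E).
  apply/measurable_EFinP; apply: measurableT_comp.
    exact: measurable_normal_pdf.
  by apply: measurable_funD => //; exact: measurable_cst.
rewrite /normal_prob.
transitivity (\int[pushforward leb
    ((fun x => x + b)%R : measurableTypeR R -> measurableTypeR R)]_(x in B)
    (normal_pdf 0 1 (x - b))%:E).
  under eq_integral => x _ do rewrite E.
  apply: eq_measure_integral => A mA _.
  by apply/esym; exact: lebesgue_measure_shift.
rewrite ge0_integral_pushforward//=.
- by apply: eq_integral => x _ /=; rewrite addrK.
- exact: measurable_funTS.
- by move=> x _; rewrite lee_fin normal_pdf_ge0.
Qed.

End NormalTilt.

Section GaussianTilt.
Context {R : realType} {disp : measure_display} {T : measurableType disp}.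
Variable P : probability T R.
Local Open Scope ereal_scope.

(** This carries [normal_tilt] to the law of [X], by [ge0_integral_law] on the Lebesgue line with
    [Y] the identity and [W] the normal density. *)
Lemma distribution_tilt (X : {RV P >-> R}) (b : R) (B : set R) :
  standard_normal X -> measurable B ->
  \int[distribution P X]_x (\1_B x * expR (b * x - b ^+ 2 / 2))%:E =
  normal_prob 0 1 ((fun x : R => (x + b)%R) @^-1` B).
Proof.
move=> nX mB; rewrite -normal_tilt//.
have mid : measurable_fun setT (idfun : measurableTypeR R -> R).
  exact: measurable_id.
pose Y : {mfun measurableTypeR R >-> R} :=
  HB.pack (idfun : measurableTypeR R -> R)
    (isMeasurableFun.Build _ _ _ _ _ mid).
have mf : measurable_fun setT
    (fun x : R => \1_B x * expR (b * x - b ^+ 2 / 2))%R.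
  apply: measurable_funM; first exact: measurable_indic.
  apply: measurableT_comp => //; exact: measurable_funD.
rewrite -(@ge0_integral_law _ _ _ (@lebesgue_measure R) _ Y
    (normal_pdf 0 1) _ _ _ mf)//=; last 3 first.
- exact: measurable_normal_pdf.
- by move=> x; exact: normal_pdf_ge0.
- by move=> A mA; rewrite nX.
rewrite [RHS]integral_mkcond; apply: eq_integral => x _.
by rewrite patchE indicE; case: ifP; rewrite ?mul1r ?mul0r.
Qed.

End GaussianTilt.

(** * The Cameron-Martin formula *)

Section CameronMartin.
Context {R : realType} {disp : measure_display} {T : measurableType disp}.
Variable P : probability T R.
Context {K : finType}.
Local Open Scope ereal_scope.

(* Their generated sigma-algebra is the product one on [K -> R]. *)
Definition rectangles : set (set (K -> R)) :=
  [set A | exists B : K -> set R,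
    (forall k, measurable (B k)) /\ A = [set f | forall k, B k (f k)]].

(** The mass of [B] under the normal law of mean [b] and variance 1, as a real number so that it can
    be multiplied over coordinates. *)
Definition gauss_shift (b : R) (B : set R) : R :=
  fine (normal_prob 0 1 ((fun x : R => (x + b)%R) @^-1` B)).

Lemma gauss_shift_ge0 b B : (0 <= gauss_shift b B)%R.
Proof. by rewrite fine_ge0// measure_ge0. Qed.

Lemma gauss_shiftE b (B : set R) : measurable B ->
  (gauss_shift b B)%:E = normal_prob 0 1 ((fun x : R => (x + b)%R) @^-1` B).
Proof.
by move=> mB; rewrite fineK// fin_num_measure//; exact: measurable_shift.
Qed.

Variable g : K -> {RV P >-> R}.
Hypothesis indep : mutually_independent g.
Hypothesis gauss : forall k, standard_normal (g k).

Let rect (B : K -> set R) : set T := [set w | forall k, B k (g k w)].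

Let rectE B : rect B = \bigcap_(k in [set` [set: K]%SET]) (g k @^-1` B k).
Proof.
by apply/seteqP; split => w /= h k;
  [move=> _; exact: h|apply: h; rewrite /= inE].
Qed.

Let measurable_pre k (B : set R) : measurable B -> measurable (g k @^-1` B).
Proof.
by move=> mB; rewrite -[X in measurable X]setTI; exact: measurable_funP.
Qed.

Lemma measurable_rect B : (forall k, measurable (B k)) ->
  measurable [set w | forall k, B k (g k w)].
Proof.
move=> mB; rewrite -/(rect B) rectE; apply: fin_bigcap_measurable.
  exact: finite_finset.
by move=> k _; exact: measurable_pre.
Qed.

Lemma probability_rect B : (forall k, measurable (B k)) ->
  P [set w | forall k, B k (g k w)] = (\prod_k gauss_shift 0 (B k))%:E.
Proof.
move=> mB; rewrite -/(rect B) rectE indep// -prodEFin big_mkcond/=.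
apply: eq_bigr => k _; rewrite inE gauss_shiftE//.
have -> : (fun x : R => (x + 0)%R) @^-1` (B k) = B k.
  by apply/seteqP; split => x /=; rewrite addr0.
by rewrite -(gauss k).
Qed.

(** The likelihood ratio of Gaussian coordinates with means [b] on [S] against centred ones. Taking
    a sequence [S] rather than all of [K] allows induction on the tilted coordinates. *)
Definition tilt (b : K -> R) (S : seq K) (w : T) : R :=
  expR (\sum_(k <- S) (b k * g k w - b k ^+ 2 / 2)).

Lemma measurable_tilt b S : measurable_fun setT (tilt b S).
Proof.
apply: measurableT_comp => //; apply: measurable_sum => k.
apply: measurable_funD => //.
exact: measurable_funM.
Qed.

(* Adding [l] to [S] integrates out [g l] alone: by the induction hypothesis,
   the measure [B |-> int_{A, g l in B} tilt b S] is a multiple of the law of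
   [g l], where [A] constrains the other coordinates. *)
Lemma tilt_rect b S B : uniq S -> (forall k, measurable (B k)) ->
  \int[P]_(w in [set w | forall k, B k (g k w)]) (tilt b S w)%:E =
  (\prod_k gauss_shift (if k \in S then b k else 0%R) (B k))%:E.
Proof.
elim: S B => [|l S IH] B.
  move=> _ mB; rewrite -probability_rect//.
  under eq_integral => w _ do rewrite /tilt big_nil expR0.
  by rewrite integral_cst ?mul1e//; exact: measurable_rect.
rewrite cons_uniq => /andP[lS uS] mB.
(* [B' C] replaces the constraint on coordinate [l] by [C]; [B' setT] drops it. *)
pose B' (C : set R) k := if k == l then C else B k.
have mB' C : measurable C -> forall k, measurable (B' C k).
  by move=> mC k; rewrite /B'; case: ifP.
pose W w := (\1_(rect (B' setT)) w * tilt b S w)%R.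
pose c := (\prod_(k | k != l)
  gauss_shift (if k \in S then b k else 0%R) (B k))%R.
have c0 : (0 <= c)%R by apply: prodr_ge0 => k _; exact: gauss_shift_ge0.
have law C : measurable C ->
    \int[P]_(w in g l @^-1` C) (W w)%:E =
    mscale (NngNum c0) (distribution P (g l)) C.
  move=> mC; rewrite /mscale/=.
  transitivity (\int[P]_(w in rect (B' C)) (tilt b S w)%:E).
    rewrite [LHS]integral_mkcond [RHS]integral_mkcond.
    apply: eq_integral => w _; rewrite !patchE /W indicE.
    have -> : (w \in rect (B' C)) =
        (w \in g l @^-1` C) && (w \in rect (B' setT)).
      apply/idP/andP => [|[]]; rewrite !inE /rect /B' /=;
        [move=> h|move=> h1 h2 k].
        split; first by have := h l; rewrite eqxx.
        by move=> k; have := h k; case: ifP.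
      by have := h2 k; case: ifP => // /eqP ->.
    by case: ifP => //= _; case: ifP; rewrite ?mul1r ?mul0r.
  rewrite IH//; last exact: mB'.
  rewrite (bigD1 l)//= (negbTE lS) /B' eqxx mulrC EFinM; congr (_ * _).
    by congr EFin; apply: eq_bigr => k /negbTE ->.
  rewrite gauss_shiftE// -(gauss l); last exact: measurable_shift.
  congr (pushforward _ _ _).
  by apply/seteqP; split => x /=; rewrite addr0.
transitivity (\int[P]_w
    (\1_(B l) (g l w) * expR (b l * g l w - b l ^+ 2 / 2) * W w)%:E).
  rewrite [LHS]integral_mkcond; apply: eq_integral => w _.
  rewrite patchE /W /tilt big_cons expRD !indicE.
  have -> : (w \in [set w | forall k, B k (g k w)]) =
      (g l w \in B l) && (w \in rect (B' setT)).
    apply/idP/andP => [|[]]; rewrite !inE /rect /B' /=;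
      [move=> h|move=> h1 h2 k].
      by split => // k; case: ifP.
    by have := h2 k; case: ifP => // /eqP ->.
  by case: (_ \in B l); case: (_ \in rect _); rewrite /= ?(mul1r, mul0r, mulr0).
have mf : measurable_fun setT
    (fun x : R => \1_(B l) x * expR (b l * x - b l ^+ 2 / 2))%R.
  apply: measurable_funM; first exact: measurable_indic.
  apply: measurableT_comp => //; exact: measurable_funD.
have f0 (x : R) : (0 <= \1_(B l) x * expR (b l * x - b l ^+ 2 / 2))%R.
  by rewrite mulr_ge0 ?expR_ge0// indicE ler0n.
rewrite (ge0_integral_law _ _ mf f0 law); last 2 first.
- apply: measurable_funM; last exact: measurable_tilt.
  by apply: measurable_indic; apply: measurable_rect; exact: mB'.
- by move=> w; rewrite mulr_ge0 ?expR_ge0// indicE ler0n.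
rewrite ge0_integral_mscale//; last exact/measurable_EFinP.
rewrite distribution_tilt// -gauss_shiftE// -EFinM; congr EFin.
rewrite [RHS](bigD1 l)//= mem_head mulrC; congr (_ * _)%R.
by apply: eq_bigr => k kl; rewrite inE (negbTE kl).
Qed.

Definition coords (w : T) : g_sigma_algebraType rectangles := fun k => g k w.

Definition shifted_coords (b : K -> R) (w : T) :
  g_sigma_algebraType rectangles := fun k => (g k w + b k)%R.

Lemma measurable_shifted_coords b : measurable_fun setT (shifted_coords b).
Proof.
apply: (@measurability _ _ _ (g_sigma_algebraType rectangles) setT
  (shifted_coords b) rectangles) => // _ [_ [B [mB ->]] <-].
rewrite setTI; apply: (@measurable_rect
  (fun k => (fun x : R => (x + b k)%R) @^-1` (B k))) => k.
exact: measurable_shift.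
Qed.

Lemma measurable_coords : measurable_fun setT coords.
Proof.
apply: (@measurability _ _ _ (g_sigma_algebraType rectangles) setT
  (coords) rectangles) => // _ [_ [B [mB ->]] <-].
by rewrite setTI; exact: measurable_rect.
Qed.

(** Both sides are measures in [A]. They agree on rectangles by [tilt_rect] and [probability_rect],
    and rectangles form a generating class stable under intersection. *)
Lemma cameron_martin b (A : set (g_sigma_algebraType rectangles)) :
  measurable A ->
  \int[P]_(w in coords @^-1` A) (tilt b (enum K) w)%:E =
  P (shifted_coords b @^-1` A).
Proof.
move=> mA.
have tilt0 w : (0 <= tilt b (enum K) w)%R by exact: expR_ge0.
have mtilt := measurable_tilt b (enum K).
have mc := measurable_coords.
have ms := measurable_shifted_coords b.
pose m1 : {measure set (g_sigma_algebraType rectangles) -> \bar R} :=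
  pushforward (mdensity_measure P mtilt tilt0) coords.
pose m2 : {measure set (g_sigma_algebraType rectangles) -> \bar R} :=
  pushforward P (shifted_coords b).
rewrite -[LHS]/(m1 mc A) -[RHS]/(m2 ms A).
apply: (@measure_unique _ R (g_sigma_algebraType rectangles) rectangles
  (fun _ => setT) _ _ _ _ (m1 mc) (m2 ms) _ _ A mA) => //.
- move=> _ _ [B1 [mB1 ->]] [B2 [mB2 ->]].
  exists (fun k => B1 k `&` B2 k); split; first by move=> k; exact: measurableI.
  apply/seteqP; split => f /=; first by move=> [h1 h2] k; split.
  by move=> h; split => k; have [] := h k.
- move=> _; exists (fun=> setT); split => //.
  by apply/seteqP; split.
- by rewrite bigcup_const.
- move=> _ [B [mB ->]].
  rewrite -[LHS]/(\int[P]_(w in [set w | forall k, B k (g k w)])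
    (tilt b (enum K) w)%:E) tilt_rect ?enum_uniq//.
  rewrite -[RHS]/(P [set w | forall k,
    ((fun x : R => (x + b k)%R) @^-1` B k) (g k w)]).
  rewrite (@probability_rect (fun k => (fun x : R => (x + b k)%R) @^-1` B k)).
    2: by move=> k; exact: measurable_shift.
  congr EFin; apply: eq_bigr => k _; rewrite mem_enum inE /gauss_shift.
  congr (fine (normal_prob _ _ _)).
  by apply/seteqP; split => x /=; rewrite addr0.
(* Uniqueness needs finite mass on the covering sets, here the whole space; by [tilt_rect] this mass
   is a finite product of reals. *)
- move=> _; rewrite -[ltLHS]/(\int[P]_w (tilt b (enum K) w)%:E).
  have := @tilt_rect b (enum K) (fun=> setT) (enum_uniq _) (fun=> measurableT).
  have -> : [set w | forall k : K, (fun=> [set: R]) k (g k w)] = setT.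
    by apply/seteqP; split.
  by move=> ->; rewrite ltry.
Qed.

(** On the event, 1 is at most the exponential of [\sum_k b k * g k w - tau], which is [tilt] times
    the constant of the bound; integrating over [A] and applying [cameron_martin] trades the tilt
    for a shift. [A] stays on the right because it will later be invariant under this shift. *)
Lemma gaussian_chernoff (b : K -> R) (tau : R)
    (A : set (g_sigma_algebraType rectangles)) : measurable A ->
  P [set w | A (coords w) /\ (tau <= \sum_k b k * g k w)%R] <=
  (expR ((\sum_k b k ^+ 2) / 2 - tau))%:E * P (shifted_coords b @^-1` A).
Proof.
move=> mA; rewrite -cameron_martin//.
have mcA : measurable (coords @^-1` A).
  by rewrite -[X in measurable X]setTI; exact: measurable_coords.
have mL : measurable_fun setT (fun w => \sum_k b k * g k w)%R.
  by apply: measurable_sum => k; exact: measurable_funM.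
have mE : measurable [set w | (tau <= \sum_k b k * g k w)%R].
  rewrite -[X in measurable X]setTI.
  have := mL measurableT `[tau, +oo[%classic (measurable_itv _).
  rewrite (_ : _ @^-1` _ = [set w | (tau <= \sum_k b k * g k w)%R])//.
  by apply/seteqP; split => w /=; rewrite in_itv/= andbT.
have mt : measurable_fun setT (EFin \o tilt b (enum K)).
  by apply/measurable_EFinP; exact: measurable_tilt.
rewrite -ge0_integralZl//; last 2 first.
- exact: measurable_funTS.
- by move=> w _; rewrite lee_fin expR_ge0.
rewrite -[X in P X]/(coords @^-1` A `&`
  [set w | (tau <= \sum_k b k * g k w)%R]).
rewrite -[leLHS]mul1e -(integral_cst P _ 1); last exact: measurableI.
rewrite integral_mkcondr; apply: ge0_le_integral => //.
- by move=> w _; rewrite patchE; case: ifP.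
- apply: measurable_funTS; apply/(measurable_restrictT _ mE).
  exact: measurable_cst.
- by apply: emeasurable_funM => //; exact: measurable_funTS.
move=> w _; rewrite patchE; case: ifP => [/[!inE] /= h|_]; last first.
  by rewrite mule_ge0// lee_fin expR_ge0.
rewrite /tilt -EFinM -expRD lee_fin big_split/= sumrN -mulr_suml.
rewrite big_enum/= big_enum/=.
rewrite -[leLHS]expR0 ler_expR; lra.
Qed.

End CameronMartin.

(** * Ranks *)

Section Ranks.
Context {R : realType} {D : nat}.
Variable s0 : nat.
Implicit Types Q Z : 'I_D -> R.

(** The score sums over ranks, so only the set of indices matters; it takes finitely many values,
    along which the sample space can be split. *)
Definition top_ranks Q : {set 'I_D} := [set i in take s0 (desc_order Q)]%SET.
Definition bottom_ranks Q : {set 'I_D} :=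
  [set i in drop (D - s0) (desc_order Q)]%SET.

Lemma size_desc_order Q : size (desc_order Q) = D.
Proof. by rewrite size_sort size_enum_ord. Qed.

Lemma uniq_desc_order Q : uniq (desc_order Q).
Proof. by rewrite sort_uniq enum_uniq. Qed.

Lemma mem_desc_order Q i : i \in desc_order Q.
Proof. by rewrite mem_sort mem_enum. Qed.

Lemma sorted_desc_order Q : sorted (fun i j => Q j <= Q i) (desc_order Q).
Proof. by apply: sort_sorted => i j; exact: le_total. Qed.

Lemma desc_order_le Q i j :
  (index i (desc_order Q) <= index j (desc_order Q))%N ->
  Q j <= Q i.
Proof.
have tr : transitive (fun i j => Q j <= Q i).
  by move=> y x z xy yz; exact: le_trans yz xy.
move=> ij; apply: (sorted_leq_index tr _ (sorted_desc_order Q)) => //;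
  exact: mem_desc_order.
Qed.

Lemma sum_top_ranks Q Z : (s0 <= D)%N ->
  \sum_(1 <= r < s0.+1) concomitant Q Z r = \sum_(i in top_ranks Q) Z i.
Proof.
move=> s0D; rewrite big_add1/= /concomitant.
rewrite -[RHS]big_enum/= (perm_big (take s0 (desc_order Q)))/=; last first.
  apply: uniq_perm; [exact: enum_uniq|exact/take_uniq/uniq_desc_order|].
  by move=> i; rewrite mem_enum inE.
rewrite -[RHS](big_map Z xpredT (fun x => x)) [RHS](big_nth 0)
  size_map size_takel ?size_desc_order//.
rewrite big_nat_cond [RHS]big_nat_cond.
apply: eq_bigr => k /andP[/andP[_ ks] _].
by rewrite map_take nth_take.
Qed.

Lemma sum_bottom_ranks Q Z : (s0 <= D)%N ->
  \sum_(1 <= r < s0.+1) concomitant Q Z (D - r + 1) =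
  \sum_(i in bottom_ranks Q) Z i.
Proof.
(* Reversing the summation makes [D - r + 1] increase, matching the order of [drop (D - s0)]. *)
move=> s0D; rewrite big_nat_rev big_add1/= /concomitant.
rewrite -[RHS]big_enum/= (perm_big (drop (D - s0) (desc_order Q)))/=; last first.
  apply: uniq_perm; [exact: enum_uniq|exact/drop_uniq/uniq_desc_order|].
  by move=> i; rewrite mem_enum inE.
rewrite -[RHS](big_map Z xpredT (fun x => x)) [RHS](big_nth 0)
  size_map size_drop size_desc_order.
have -> : (D - (D - s0) = s0)%N by lia.
rewrite big_nat_cond [RHS]big_nat_cond.
apply: eq_bigr => k /andP[/andP[_ ks] _].
rewrite map_drop nth_drop; congr (nth _ _ _); lia.
Qed.

Lemma card_top_ranks Q : (s0 <= D)%N -> #|top_ranks Q| = s0.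
Proof.
move=> s0D; rewrite cardsE (card_uniqP _); last first.
  exact/take_uniq/uniq_desc_order.
by rewrite size_takel ?size_desc_order.
Qed.

Lemma card_bottom_ranks Q : (s0 <= D)%N -> #|bottom_ranks Q| = s0.
Proof.
move=> s0D; rewrite cardsE (card_uniqP _); last first.
  exact/drop_uniq/uniq_desc_order.
by rewrite size_drop size_desc_order; lia.
Qed.

(** If [Q i < a], all the indices [j] with [a <= Q j], at least [s0] of them, precede [i] in the
    order, so [i] cannot be among the first [s0]. *)
Lemma top_ranks_ge Q (a : R) i : (s0 <= #|[pred j | (a <= Q j)%R]|)%N ->
  i \in top_ranks Q -> a <= Q i.
Proof.
move=> h; rewrite inE in_take ?mem_desc_order// => iQ.
rewrite leNgt; apply/negP => Qia.
suff : (#|[pred j | (a <= Q j)%R]| <= index i (desc_order Q))%N.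
  by move/(leq_trans h); rewrite leqNgt iQ.
apply: leq_trans (_ : size (take (index i (desc_order Q)) (desc_order Q)) <= _)%N.
  apply: leq_trans (card_size _); apply: subset_leq_card.
  apply/fintype.subsetP => j; rewrite inE => aj.
  rewrite in_take ?mem_desc_order// ltnNge; apply/negP => /desc_order_le ji.
  by have := le_trans aj ji; rewrite leNgt Qia.
by rewrite size_take; case: ifP => // /negbT; rewrite -leqNgt.
Qed.

Lemma bottom_ranks_le Q (a : R) i : (s0 <= #|[pred j | (Q j <= a)%R]|)%N ->
  i \in bottom_ranks Q -> Q i <= a.
Proof.
move=> h; rewrite inE => iQ.
rewrite leNgt; apply/negP => Qia.
have iD : (D - s0 <= index i (desc_order Q))%N.
  rewrite leqNgt -in_take ?mem_desc_order//.
  have := uniq_desc_order Q; rewrite -[X in uniq X](cat_take_drop (D - s0)).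
  by rewrite cat_uniq => /and3P[_ /hasPn/(_ _ iQ)].
have iD' : (index i (desc_order Q) < D)%N.
  by rewrite -[ltnRHS](size_desc_order Q) index_mem mem_desc_order.
suff : (#|[pred j | (Q j <= a)%R]| <= D - (index i (desc_order Q)).+1)%N.
  by move/(leq_trans h); move: iD iD'; move: (index i _) => k; lia.
rewrite -[X in (_ <= X - _)%N](size_desc_order Q) -size_drop.
apply: leq_trans (card_size _); apply: subset_leq_card.
apply/fintype.subsetP => j; rewrite inE => aj.
have := mem_desc_order Q j.
rewrite -[X in _ \in X -> _](cat_take_drop (index i (desc_order Q)).+1) mem_cat.
case/orP => //; rewrite in_take ?mem_desc_order// ltnS => /desc_order_le ij.
by have := le_trans ij aj; rewrite leNgt Qia.
Qed.

End Ranks.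

(** * Measurability of rank events *)

Section RankMeasurability.
Context {R : realType} {D : nat} {disp : measure_display}.
Context {T : measurableType disp}.
Variable Q : 'I_D -> T -> R.
Hypothesis mQ : forall i, measurable_fun setT (Q i).

Lemma measurable_le_fun (f h : T -> R) : measurable_fun setT f ->
  measurable_fun setT h -> measurable [set w | f w <= h w].
Proof.
move=> mf mh; rewrite -[X in measurable X]setTI.
exact: (measurable_fun_le measurableT mf mh).
Qed.

(** The sorted sequence is a function of the finite matrix of comparisons between the [Q i], so the
    event is a finite union of cells [E M], each a finite intersection of comparison events or their
    complements. *)
Lemma measurable_desc_order (F : set (seq 'I_D)) :
  measurable [set w | F (desc_order (fun i => Q i w))].
Proof.
pose E (M : {ffun 'I_D * 'I_D -> bool}) : set T :=
  \bigcap_(ij in [set: 'I_D * 'I_D]) [set w | (Q ij.2 w <= Q ij.1 w) = M ij].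
have mE M : measurable (E M).
  apply: fin_bigcap_measurable => // -[i j] _ /=.
  have mij : measurable [set w | Q j w <= Q i w] by exact: measurable_le_fun.
  case: (M (i, j)) => //.
  rewrite (_ : [set _ | _] = ~` [set w | Q j w <= Q i w]).
    exact: measurableC.
  by apply/seteqP; split => w /=; [move=> ->|case: (_ <= _)].
rewrite (_ : [set w | _] = \bigcup_(M in [set M : {ffun 'I_D * 'I_D -> bool} |
    F (sort (fun i j => M (i, j)) (enum 'I_D))]) E M).
  exact: fin_bigcup_measurable.
apply/seteqP; split => w /=.
  move=> Fw; exists [ffun ij => Q ij.2 w <= Q ij.1 w].
    rewrite /= (_ : (fun i j => _) = (fun i j => Q j w <= Q i w))//.
    by apply/funext => i; apply/funext => j; rewrite ffunE.
  by move=> ij _ /=; rewrite ffunE.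
move=> [M /= FM EM]; rewrite /desc_order.
by rewrite (_ : (fun i j => _) = (fun i j => M (i, j)))//;
  apply/funext => i; apply/funext => j; exact: (EM (i, j)).
Qed.

End RankMeasurability.

(** * Euclidean geometry *)

Section Geometry.
Context {R : realType} {d : nat}.
Implicit Types u v w q x y z : 'cV[R]_d.

Lemma dotE u v : dot u v = \sum_j u j 0 * v j 0.
Proof. by rewrite /dot mxE; apply: eq_bigr => j _; rewrite mxE. Qed.

Lemma dotC u v : dot u v = dot v u.
Proof. by rewrite !dotE; apply: eq_bigr => j _; rewrite mulrC. Qed.

Lemma dotDr u v w : dot u (v + w) = dot u v + dot u w.
Proof. by rewrite /dot mulmxDr mxE. Qed.

Lemma dotZr u (a : R) v : dot u (a *: v) = a * dot u v.
Proof. by rewrite /dot -scalemxAr mxE. Qed.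

Lemma dotBr u v w : dot u (v - w) = dot u v - dot u w.
Proof. by rewrite dotDr -scaleN1r dotZr mulN1r. Qed.

Lemma dotDl u v w : dot (u + v) w = dot u w + dot v w.
Proof. by rewrite dotC dotDr !(dotC w). Qed.

Lemma dotZl (a : R) u v : dot (a *: u) v = a * dot u v.
Proof. by rewrite dotC dotZr dotC. Qed.

Lemma dotBl u v w : dot (u - v) w = dot u w - dot v w.
Proof. by rewrite dotC dotBr !(dotC w). Qed.

Lemma dot_sumr (I : Type) (r : seq I) (A : pred I) u (f : I -> 'cV[R]_d) :
  dot u (\sum_(i <- r | A i) f i) = \sum_(i <- r | A i) dot u (f i).
Proof.
elim/big_rec2 : _ => [|i _ v _ <-]; last by rewrite dotDr.
by rewrite /dot mulmx0 mxE.
Qed.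

Lemma dot_ge0 u : 0 <= dot u u.
Proof. by rewrite dotE sumr_ge0// => j _; rewrite -expr2 sqr_ge0. Qed.

Lemma enorm_ge0 u : 0 <= enorm u.
Proof. exact: sqrtr_ge0. Qed.

Lemma enorm_sqr u : enorm u ^+ 2 = dot u u.
Proof. by rewrite sqr_sqrtr// dot_ge0. Qed.

Lemma enorm_le u (a : R) : 0 <= a -> dot u u <= a ^+ 2 -> enorm u <= a.
Proof.
move=> a0 ua.
by rewrite -(ler_pXn2r (n := 2))// ?nnegrE ?enorm_ge0// enorm_sqr.
Qed.

Lemma dot_enorm0 u v : enorm u = 0 -> dot u v = 0.
Proof.
move=> u0; have : dot u u = 0 by rewrite -enorm_sqr u0 expr0n.
rewrite !dotE => /eqP; rewrite psumr_eq0; last first.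
  by move=> j _; rewrite -expr2 sqr_ge0.
move=> /allP h; apply: big1 => j _.
have := h j (mem_index_enum _); rewrite /= -expr2 sqrf_eq0 => /eqP ->.
by rewrite mul0r.
Qed.

Lemma cauchy_schwarz u v : dot u v <= enorm u * enorm v.
Proof.
have [u0|/eqP u0] := eqVneq (enorm u) 0; first by rewrite dot_enorm0// u0 mul0r.
have [v0|/eqP v0] := eqVneq (enorm v) 0.
  by rewrite dotC dot_enorm0// v0 mulr0.
have up : 0 < enorm u by rewrite lt0r enorm_ge0 andbT; exact/eqP.
have vp : 0 < enorm v by rewrite lt0r enorm_ge0 andbT; exact/eqP.
have := dot_ge0 (enorm v *: u - enorm u *: v).
rewrite !(dotBl, dotBr, dotZl, dotZr) -!enorm_sqr (dotC v u).
have uvp := mulr_gt0 up vp.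
rewrite (_ : _ - _ = 2 * (enorm u * enorm v) * (enorm u * enorm v - dot u v)).
  by rewrite pmulr_rge0 ?subr_ge0// mulr_gt0.
ring.
Qed.

Lemma cauchy_schwarzN u v : - (enorm u * enorm v) <= dot u v.
Proof.
rewrite lerNl -mulN1r -dotZl; apply: le_trans (cauchy_schwarz _ _) _.
rewrite ler_wpM2r ?enorm_ge0// enorm_le ?enorm_ge0//.
by rewrite dotZl dotZr enorm_sqr !mulN1r opprK.
Qed.

Lemma sum_sqr_unit u : enorm u = 1 -> \sum_j u j 0 ^+ 2 = 1.
Proof.
move=> u1; have := enorm_sqr u; rewrite u1 expr1n dotE => ->.
by apply: eq_bigr => j _; rewrite expr2.
Qed.

Definition perp q z := z - dot z q *: q.

Lemma dot_perp_q q z : enorm q = 1 -> dot (perp q z) q = 0.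
Proof.
by move=> q1; rewrite /perp dotBl dotZl -enorm_sqr q1 expr1n mulr1 subrr.
Qed.

Lemma dot_perpr q u v : enorm q = 1 -> dot (perp q u) v = dot u (perp q v).
Proof.
move=> q1; rewrite /perp dotBl dotZl dotBr dotZr (dotC v q); ring.
Qed.

Lemma dot_decomp q z v : enorm q = 1 ->
  dot z v = dot z q * dot q v + dot (perp q z) (perp q v).
Proof.
move=> q1; rewrite {2}/perp dotBr dotZr dot_perp_q// mulr0 subr0.
by rewrite /perp dotBl dotZl addrC subrK.
Qed.

(** This identifies the square roots in the denominator of [alpha] with norms of orthogonal
    components. *)
Lemma enorm_perp q z : enorm q = 1 ->
  Num.sqrt (enorm z ^+ 2 - dot z q ^+ 2) = enorm (perp q z).
Proof.
move=> q1; rewrite enorm_sqr (dot_decomp z z q1) (dotC q z).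
by rewrite -expr2 [X in Num.sqrt (X - _)]addrC addrK.
Qed.

Lemma enorm_perp_le q z : enorm q = 1 -> enorm (perp q z) <= enorm z.
Proof.
move=> q1; apply: enorm_le; first exact: enorm_ge0.
rewrite enorm_sqr (dot_decomp z z q1) (dotC q z) -expr2 lerDr; exact: sqr_ge0.
Qed.

(** By [dot_decomp], [dot x v - dot y v] is the gap times [dot q v] plus a difference of orthogonal
    terms, which is at least [- s * enorm (perp q v)] by Cauchy-Schwarz. The bound on [alpha] makes
    the gap at least [kappa * s]. *)
Lemma alpha_separation (kappa : R) q x y v : enorm q = 1 -> 0 < kappa ->
  dot y q <= dot x q -> kappa ^+ 2 < alpha q x y ^+ 2 ->
  enorm (perp q v) <= kappa * dot q v -> dot y v <= dot x v.
Proof.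
move=> q1 k0 yx; rewrite /alpha !enorm_perp// => ka pv.
set s := enorm (perp q x) + enorm (perp q y).
have s0 : 0 <= s by rewrite addr_ge0// enorm_ge0.
have qv0 : 0 <= dot q v.
  by rewrite -(pmulr_rge0 _ k0); apply: le_trans pv; exact: enorm_ge0.
have sp : 0 < s.
  (* Since [0^-1 = 0], a zero denominator would give [alpha = 0], against [ka]. *)
  rewrite lt0r s0 andbT; apply/eqP => s_eq0.
  by move: ka; rewrite -/s s_eq0 invr0 mulr0 expr0n/= ltNge sqr_ge0.
have ks : kappa * s <= dot x q - dot y q.
  rewrite -ler_pdivlMr//; apply: ltW.
  by rewrite -(ltr_pXn2r (n := 2))// nnegrE ?(ltW k0)// divr_ge0// subr_ge0.
rewrite -subr_ge0 (dot_decomp x v q1) (dot_decomp y v q1).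
have := cauchy_schwarzN (perp q x) (perp q v).
have := cauchy_schwarz (perp q y) (perp q v).
have : s * enorm (perp q v) <= (dot x q - dot y q) * dot q v.
  apply: (@le_trans _ _ (s * (kappa * dot q v))); first exact: ler_wpM2l.
  by rewrite mulrA (mulrC s) ler_wpM2r.
rewrite /s; lra.
Qed.

End Geometry.

(** The net consists of points of the grid of mesh [1 / k] in the cube. The direction of [v] is
    rounded down coordinatewise, with an error of norm at most [d / k <= eta]. *)
Lemma sphere_net (R : realType) (d : nat) (eta : R) : 0 < eta ->
  exists H : seq 'cV[R]_d,
    (forall h, h \in H -> enorm h <= 1 + eta) /\
    (forall v : 'cV[R]_d, 0 < enorm v ->
      exists2 h, h \in H & (1 - eta) * enorm v <= dot h v).
Proof.
move=> eta0; pose k := (Num.trunc (d%:R / eta)).+1.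
have kp : 0 < k%:R :> R by rewrite ltr0n.
have dk : d%:R / k%:R <= eta.
  rewrite ler_pdivrMr// mulrC -ler_pdivrMr//; apply: ltW.
  exact: truncnS_gt.
pose pt (f : {ffun 'I_d -> 'I_(2 * k).+1}) : 'cV[R]_d :=
  \col_j ((f j)%:R / k%:R - 1).
exists [seq h <- [seq pt f | f <- enum {ffun 'I_d -> 'I_(2 * k).+1}] |
  enorm h <= 1 + eta].
split; first by move=> h; rewrite mem_filter => /andP[].
move=> v v0; pose u := (enorm v)^-1 *: v.
have u1 : dot u u = 1.
  by rewrite dotZl dotZr -enorm_sqr mulrA -expr2 -exprMn mulVf ?expr1n// gt_eqF.
have enu : enorm u = 1 by rewrite /enorm u1 sqrtr1.
have uj j : -1 <= u j 0 <= 1.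
  rewrite -ler_norml -(ler_pXn2r (n := 2))// ?nnegrE// expr1n real_normK ?num_real//.
  rewrite -u1 dotE (bigD1 j)//= -expr2 lerDl sumr_ge0// => i _.
  by rewrite -expr2 sqr_ge0.
pose t j := k%:R * (u j 0 + 1).
have t0 j : 0 <= t j.
  by apply: mulr_ge0 => //; have /andP[] := uj j; rewrite -lerBlDr sub0r.
have tt j : (Num.trunc (t j) < (2 * k).+1)%N.
  rewrite ltnS -(ler_nat R); apply: (@le_trans _ _ (t j)).
    by rewrite truncn_le.
  rewrite /t natrM mulrC ler_wpM2r//; have /andP[_] := uj j; lra.
pose f := [ffun j => Ordinal (tt j)].
have close j : (pt f j 0 - u j 0) ^+ 2 <= k%:R^-2.
  rewrite mxE ffunE/=.
  have h1 : (Num.trunc (t j))%:R <= t j by rewrite truncn_le.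
  have h2 := truncnS_gt (t j).
  have -> : (Num.trunc (t j))%:R / k%:R - 1 - u j 0 =
      ((Num.trunc (t j))%:R - t j) / k%:R :> R.
    by rewrite /t; field; rewrite gt_eqF.
  rewrite exprMn exprVn ler_piMl ?invr_ge0 ?exprn_ge0//.
  rewrite -natr1 in h2; nra.
have hu : enorm (pt f - u) <= eta.
  apply: enorm_le; first exact: ltW.
  apply: (@le_trans _ _ (d%:R * k%:R^-2)).
    rewrite dotE -[d in d%:R]card_ord -sum1_card natr_sum mulr_suml.
    apply: ler_sum => j _; rewrite mul1r -expr2.
    rewrite (_ : (pt f - u) j 0 = pt f j 0 - u j 0) ?close//.
    by rewrite mxE [X in _ + X]mxE.
  (* The crude bound [d <= d ^ 2] avoids a square root of the dimension. *)
  apply: (@le_trans _ _ ((d%:R / k%:R) ^+ 2)).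
    rewrite exprMn exprVn. rewrite ler_wpM2r ?invr_ge0 ?exprn_ge0//.
    by rewrite -natrX ler_nat; case: (d) => // e; rewrite -mulnn leq_pmull.
  by rewrite ler_pXn2r// nnegrE ?divr_ge0// ltW.
exists (pt f).
  rewrite mem_filter map_f ?mem_enum// andbT.
  apply: enorm_le; first by rewrite addr_ge0// ltW.
  have -> : pt f = u + (pt f - u) by rewrite addrC subrK.
  move: (pt f - u) hu => e hu.
  rewrite dotDl !dotDr u1 (dotC e u) -(enorm_sqr e).
  have := cauchy_schwarz u e; rewrite enu mul1r => ue.
  have : enorm e ^+ 2 <= eta ^+ 2 by rewrite ler_pXn2r// nnegrE ?enorm_ge0// ltW.
  by move=> ?; lra.
have -> : pt f = u + (pt f - u) by rewrite addrC subrK.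
rewrite dotDl {1}/u dotZl -enorm_sqr expr2 mulKf ?gt_eqF//.
have := cauchy_schwarzN (pt f - u) v.
have : enorm (pt f - u) * enorm v <= eta * enorm v by rewrite ler_wpM2r// ltW.
lra.
Qed.

(** * Tail of the orthogonal component *)

Section ScoreDirection.
Context {R : realType} {D d : nat}.
Implicit Types (A B : {set 'I_D}) (rv : 'I_D -> 'cV[R]_d).

Definition score_dir A B rv : 'cV[R]_d :=
  \sum_(i in A) rv i - \sum_(i in B) rv i.

Lemma dot_score_dir A B rv u : dot u (score_dir A B rv) =
  \sum_(i in A) dot u (rv i) - \sum_(i in B) dot u (rv i).
Proof. by rewrite /score_dir dotBr !dot_sumr. Qed.

Definition ceos_dir (s0 : nat) q rv : 'cV[R]_d :=
  score_dir (top_ranks s0 (fun i => dot q (rv i)))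
            (bottom_ranks s0 (fun i => dot q (rv i))) rv.

(** The index at each rank depends on [q] alone, so the score is linear in [z], with one vector
    common to all points. *)
Lemma ceos_scoreE (s0 : nat) q rv z : (s0 <= D)%N ->
  ceos_score s0 rv q z = dot z (ceos_dir s0 q rv).
Proof.
move=> s0D; rewrite /ceos_score /= sumrB sum_top_ranks// sum_bottom_ranks//.
by rewrite dot_score_dir.
Qed.

End ScoreDirection.

Section PerpendicularTail.
Context {R : realType} {disp : measure_display} {T : measurableType disp}.
Variable P : probability T R.
Context {D d : nat}.
Variable g : 'I_D -> 'I_d -> {RV P >-> R}.
Variables (s0 : nat) (q : 'cV[R]_d).
Hypothesis s0D : (s0 <= D)%N.
Local Notation K := ('I_D * 'I_d)%type.
Local Notation rv := (random_vectors g).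

Lemma dot_random_vectors u w i : dot u (rv w i) = \sum_j u j 0 * g i j w.
Proof. by rewrite dotE; apply: eq_bigr => j _; rewrite mxE. Qed.

Lemma measurable_dot_random_vectors u i :
  measurable_fun setT (fun w => dot u (rv w i)).
Proof.
under eq_fun do rewrite dot_random_vectors.
by apply: measurable_sum => j; exact: measurable_funM.
Qed.

Lemma measurable_dot_score_dir A B u :
  measurable_fun setT (fun w => dot u (score_dir A B (rv w))).
Proof.
under eq_fun do rewrite dot_score_dir.
by apply: measurable_funB; under eq_fun do rewrite big_mkcond/=;
  apply: measurable_sum => i;
  case: (i \in _) => //; exact: measurable_dot_random_vectors.
Qed.

Definition ranks_event (AB : {set 'I_D} * {set 'I_D}) : set T :=
  [set w | top_ranks s0 (fun i => dot q (rv w i)) = AB.1 /\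
           bottom_ranks s0 (fun i => dot q (rv w i)) = AB.2].

Lemma measurable_ranks_event AB : measurable (ranks_event AB).
Proof.
apply: (measurable_desc_order (Q := fun i w => dot q (rv w i))
  (fun i => measurable_dot_random_vectors q i)
  [set s | ([set i in take s0 s]%SET = AB.1) /\
           ([set i in drop (D - s0) s]%SET = AB.2)]).
Qed.

Lemma ranks_eventT :
  \bigcup_(AB in [set: {set 'I_D} * {set 'I_D}]) ranks_event AB = setT.
Proof.
apply/seteqP; split => // w _.
by exists (top_ranks s0 (fun i => dot q (rv w i)),
  bottom_ranks s0 (fun i => dot q (rv w i))).
Qed.

(** On each cell of the partition by rank sets, the direction is a fixed signed sum, hence linear in
    the Gaussian coordinates. *)
Lemma ceos_dir_eventE (F : 'cV[R]_d -> Prop) :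
  [set w | F (ceos_dir s0 q (rv w))] =
  \bigcup_(AB in [set: {set 'I_D} * {set 'I_D}])
    (ranks_event AB `&` [set w | F (score_dir AB.1 AB.2 (rv w))]).
Proof.
apply/seteqP; split => w /=.
  by move=> Fw; exists (top_ranks s0 (fun i => dot q (rv w i)),
    bottom_ranks s0 (fun i => dot q (rv w i))).
by move=> [[A B] _ [[/= <- <-] //]].
Qed.

Lemma measurable_ceos_dir (F : 'cV[R]_d -> Prop) :
  (forall A B, measurable [set w | F (score_dir A B (rv w))]) ->
  measurable [set w | F (ceos_dir s0 q (rv w))].
Proof.
move=> mF; rewrite ceos_dir_eventE; apply: fin_bigcup_measurable => //.
by move=> AB _; apply: measurableI; [exact: measurable_ranks_event|exact: mF].
Qed.

Hypothesis iid : iid_gaussian_vectors g.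

Let gg (k : K) : {RV P >-> R} := g k.1 k.2.

Definition signs (A B : {set 'I_D}) (i : 'I_D) : R := (i \in A)%:R - (i \in B)%:R.

Lemma dot_score_dir_signs A B u w : dot u (score_dir A B (rv w)) =
  \sum_(k : K) signs A B k.1 * u k.2 0 * gg k w.
Proof.
rewrite -(pair_bigA _ (fun i j => signs A B i * u j 0 * g i j w))/=.
rewrite dot_score_dir [in X in X - _]big_mkcond [in X in _ - X]big_mkcond/=.
rewrite -sumrB; apply: eq_bigr => i _; rewrite dot_random_vectors /signs.
under [RHS]eq_bigr do rewrite -mulrA.
rewrite -mulr_sumr mulrBl !mulrb.
by case: (i \in A); case: (i \in B); rewrite ?mul1r ?mul0r.
Qed.

(** Only an inequality, since the signs cancel where [A] and [B] overlap. *)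
Lemma sum_signs_sqr (A B : {set 'I_D}) :
  \sum_i signs A B i ^+ 2 <= (#|A| + #|B|)%:R.
Proof.
rewrite natrD -!sum1_card !natr_sum [X in _ <= X + _]big_mkcond.
rewrite [X in _ <= _ + X]big_mkcond -big_split/=; apply: ler_sum => i _.
by rewrite /signs; case: (i \in A); case: (i \in B) => /=; lra.
Qed.

(** The shift [b] moves each [r_i] by a multiple of [u], which is orthogonal to [q], so it preserves
    the query signature and the rank event; [gaussian_chernoff] then returns the probability of that
    same event. *)
Lemma ranks_event_tail (A B : {set 'I_D}) u (lam tau : R) :
  dot u q = 0 -> #|A| = s0 -> #|B| = s0 ->
  (P (ranks_event (A, B) `&`
      [set w | (tau <= lam * dot u (score_dir A B (rv w)))%R]) <=
   (expR (lam ^+ 2 * dot u u * s0%:R - tau))%:E * P (ranks_event (A, B)))%E.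
Proof.
move=> uq cA cB.
have [ind gau] := iid.
pose b (k : K) := lam * (signs A B k.1 * u k.2 0).
pose Q (i : 'I_D) (f : g_sigma_algebraType (@rectangles R K)) : R :=
  \sum_j q j 0 * f (i, j).
have mproj k : measurable_fun setT
    (fun f : g_sigma_algebraType (@rectangles R K) => f k : R).
  move=> _ C mC; rewrite setTI; apply: sub_sigma_algebra.
  exists (fun k' => if k' == k then C else setT); split.
    by move=> k'; case: ifP.
  apply/seteqP; split => f /=; first by move=> fC k'; case: ifP => // /eqP ->.
  by move=> /(_ k); rewrite eqxx.
have mQ i : measurable_fun setT (Q i).
  by apply: measurable_sum => j; apply: measurable_funM => //; exact: mproj.
(* The rank event read on the space of coordinates, where the shift acts. *)
pose S : set (g_sigma_algebraType (@rectangles R K)) :=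
  [set f | top_ranks s0 (fun i => Q i f) = A /\
           bottom_ranks s0 (fun i => Q i f) = B].
have mS : measurable S.
  exact: (measurable_desc_order mQ
    [set s | ([set i in take s0 s]%SET = A) /\
           ([set i in drop (D - s0) s]%SET = B)]).
have Qc w : (fun i => Q i (coords gg w)) = (fun i => dot q (rv w i)).
  by apply/funext => i; rewrite dot_random_vectors.
have Qs w : (fun i => Q i (shifted_coords gg b w)) = (fun i => dot q (rv w i)).
  apply/funext => i; rewrite dot_random_vectors /Q /shifted_coords.
  under eq_bigr do rewrite mulrDr.
  rewrite big_split/= [X in _ + X](_ : _ = lam * signs A B i * dot u q).
    by rewrite uq mulr0 addr0.
  by rewrite dotE mulr_sumr; apply: eq_bigr => j _; rewrite /b/=; ring.
have -> : ranks_event (A, B) = shifted_coords gg b @^-1` S.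
  by apply/seteqP; split => w; rewrite /ranks_event /S /= Qs.
have dirE w : lam * dot u (score_dir A B (rv w)) = \sum_k b k * gg k w.
  rewrite dot_score_dir_signs mulr_sumr; apply: eq_bigr => k _.
  by rewrite /b !mulrA.
have gau' k : standard_normal (gg k) by exact: gau.
apply: le_trans (le_trans (gaussian_chernoff ind gau' b tau mS) _).
  rewrite (_ : _ `&` _ = [set w | S (coords gg w) /\
    (tau <= \sum_k b k * gg k w)%R])//.
  apply/seteqP; split => w /=; rewrite /S /= Qc Qs.
    by rewrite dirE.
  by rewrite dirE.
apply: lee_wpmul2r => //.
rewrite lee_fin ler_expR lerB//.
have -> : \sum_k b k ^+ 2 = lam ^+ 2 * dot u u * \sum_i signs A B i ^+ 2.
  rewrite -(pair_bigA _ (fun i j => (lam * (signs A B i * u j 0)) ^+ 2))/=.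
  rewrite mulr_sumr; apply: eq_bigr => i _; rewrite dotE mulr_sumr mulr_suml.
  by apply: eq_bigr => j _; ring.
rewrite -mulrA ler_wpM2l//; first by rewrite mulr_ge0 ?sqr_ge0 ?dot_ge0.
have := sum_signs_sqr A B; rewrite cA cB natrD; lra.
Qed.

Lemma ceos_dir_tail u (rho tau : R) : dot u q = 0 -> 0 < rho -> 0 <= tau ->
  enorm u <= rho -> (0 < s0)%N ->
  (P [set w | (tau <= dot u (ceos_dir s0 q (rv w)))%R] <=
   (expR (- (tau ^+ 2 / (4 * rho ^+ 2 * s0%:R))))%:E)%E.
Proof.
move=> uq rho0 tau0 urho s00.
have s0R : 0 < s0%:R :> R by rewrite ltr0n.
have fin : finite_set [set: {set 'I_D} * {set 'I_D}] by exact: finite_finset.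
(* The minimizer of [lam ^+ 2 * rho ^+ 2 * s0%:R - lam * tau]. *)
pose lam := tau / (2 * rho ^+ 2 * s0%:R).
have lam0 : 0 <= lam by rewrite divr_ge0// mulr_ge0// mulr_ge0// sqr_ge0.
have mset A B : measurable [set w | (tau <= dot u (score_dir A B (rv w)))%R].
  by apply: measurable_le_fun => //; exact: measurable_dot_score_dir.
rewrite (ceos_dir_eventE (fun v => tau <= dot u v)).
rewrite measure_fin_bigcup//; last 2 first.
- apply/trivIsetP => -[A B] [A' B'] _ _ /eqP neq; apply/seteqP; split => // w /=.
  by move=> [[[/= h1 h2] _] [[/= e1 e2] _]]; apply: neq; rewrite -h1 -h2 e1 e2.
- by move=> AB _; apply: measurableI; [exact: measurable_ranks_event|exact: mset].
apply: (@le_trans _ _ (\sum_(AB \in [set: {set 'I_D} * {set 'I_D}])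
  (expR (- (tau ^+ 2 / (4 * rho ^+ 2 * s0%:R))))%:E * P (ranks_event AB))%E).
  apply: lee_fsum => [|[A B] _]; first exact: finite_finset.
  (* Cells whose two sets do not both have [s0] elements are empty. *)
  have [cAB|ncAB] := pselect (#|A| = s0 /\ #|B| = s0); last first.
    rewrite (_ : ranks_event (A, B) = set0).
      by rewrite set0I !measure0 /= mule0.
    apply/seteqP; split => // w [/= hA hB]; apply: ncAB.
    by rewrite -hA -hB card_top_ranks// card_bottom_ranks.
  have [cA cB] := cAB.
  apply: le_trans (le_trans (ranks_event_tail lam (lam * tau) uq cA cB) _).
    apply: le_measure; rewrite ?inE.
    - by apply: measurableI; [exact: measurable_ranks_event|exact: mset].
    - apply: measurableI; first exact: measurable_ranks_event.
      apply: measurable_le_fun => //; apply: measurable_funM => //.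
      exact: measurable_dot_score_dir.
    - by apply: setIS => w /= h; rewrite ler_wpM2l.
  apply: lee_wpmul2r => //; rewrite lee_fin ler_expR.
  have uu : dot u u <= rho ^+ 2.
    by rewrite -enorm_sqr ler_pXn2r// nnegrE ?enorm_ge0// ltW.
  apply: (@le_trans _ _ (lam ^+ 2 * rho ^+ 2 * s0%:R - lam * tau)).
    by rewrite lerB// ler_wpM2r// ler_wpM2l// sqr_ge0.
  rewrite le_eqVlt; apply/orP; left; apply/eqP; rewrite /lam; field.
  by rewrite !gt_eqF.
(* The constant is the same for all cells and their probabilities sum to 1, so the number of cells
   does not enter the bound. *)
rewrite -ge0_mule_fsumr; last by move=> AB; exact: measure_ge0.
rewrite -measure_fin_bigcup//; last 2 first.
- apply/trivIsetP => -[A B] [A' B'] _ _ /eqP neq; apply/seteqP; split => // w /=.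
  by move=> [[/= h1 h2] [/= e1 e2]]; apply: neq; rewrite -h1 -h2 e1 e2.
- by move=> AB _; exact: measurable_ranks_event.
by rewrite ranks_eventT; rewrite [X in (_ * X)%E](probability_setT P) mule1.
Qed.

End PerpendicularTail.

(** * Large projections *)

Lemma union_bound (R : realType) (disp : measure_display)
    (T : measurableType disp) (P : {measure set T -> \bar R})
    (I : choiceType) (s : seq I) (F : I -> set T) :
  (forall i, measurable (F i)) ->
  (P (\bigcup_(i in [set` s]) F i) <= \sum_(i <- s) P (F i))%E.
Proof.
move=> mF; rewrite bigcup_seq; elim: s => [|i s IH].
  by rewrite !big_nil measure0.
rewrite !big_cons; apply: le_trans (leeD (lexx _) IH).
by apply: measureU2 => //; exact: bigsetU_measurable.
Qed.

Section OneSidedInterval.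
Context {R : realType}.

(* The unit interval adjacent to [t] on the side away from 0. *)
Definition outer_itv (t : R) : set R :=
  if 0 <= t then `[t, t + 1]%classic else `[t - 1, t]%classic.

Lemma measurable_outer_itv t : measurable (outer_itv t).
Proof. by rewrite /outer_itv; case: ifP => _; exact: measurable_itv. Qed.

Lemma outer_itv_mul t x : outer_itv t x -> t ^+ 2 <= t * x.
Proof.
rewrite /outer_itv; case: (leP 0 t) => t0 /=; rewrite in_itv/=;
  move=> /andP[h1 h2]; rewrite expr2.
  by rewrite ler_wpM2l.
by rewrite ler_wnM2l// ltW.
Qed.

(** The interval has length 1, and its points are at most [|t| + 1] in absolute value, which bounds
    the density from below. *)
Lemma gauss_shift_outer_itv t :
  normal_peak 1 * expR (- (`|t| + 1) ^+ 2 / 2) <= gauss_shift 0 (outer_itv t).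
Proof.
have mB := measurable_outer_itv t.
rewrite -lee_fin gauss_shiftE//.
have -> : (fun x : R => x + 0) @^-1` outer_itv t = outer_itv t.
  by apply/seteqP; split => x /=; rewrite addr0.
set c := normal_peak 1 * _.
have c0 : 0 <= c by rewrite mulr_ge0 ?normal_peak_ge0 ?expR_ge0.
have leb1 : (@lebesgue_measure R (outer_itv t) = 1)%E.
  rewrite /outer_itv; case: ifP => _; rewrite lebesgue_measure_itv/= lte_fin.
    by rewrite ltrDl ltr01 -EFinD addrAC subrr add0r.
  by rewrite gtrDl ltrN10 -EFinD opprB addrC subrK.
rewrite /normal_prob -[leLHS]mule1 -[X in (_ * X <= _)%E]leb1 -integral_cst//.
apply: ge0_le_integral => //.
- by apply: measurable_funTS; apply/measurable_EFinP; exact: measurable_normal_pdf.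
move=> x tx; rewrite lee_fin normal_pdfE ?oner_neq0// ler_wpM2l ?normal_peak_ge0//.
rewrite /normal_fun ler_expR subr0 expr1n.
have : x ^+ 2 <= (`|t| + 1) ^+ 2.
  rewrite -[leLHS]real_normK ?num_real// ler_pXn2r ?nnegrE ?addr_ge0//.
  move: tx; rewrite /outer_itv; case: (leP 0 t) => t0;
    rewrite /= in_itv/= => /andP[h1 h2].
    by rewrite (ger0_norm t0) ger0_norm//; exact: le_trans t0 h1.
  by rewrite (ltr0_norm t0) ler0_norm; [lra|exact: ltW (le_lt_trans h2 t0)].
lra.
Qed.

End OneSidedInterval.

Section ManyLargeProjections.
Context {R : realType} {disp : measure_display} {T : measurableType disp}.
Variable P : probability T R.
Context {D d : nat}.
Variable g : 'I_D -> 'I_d -> {RV P >-> R}.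
Hypothesis iid : iid_gaussian_vectors g.
Local Notation K := ('I_D * 'I_d)%type.
Local Notation rv := (random_vectors g).
Let gg (k : K) : {RV P >-> R} := g k.1 k.2.
Variable C : 'I_d -> set R.
Hypothesis mC : forall j, measurable (C j).

(** Constraining each coordinate of [r_i] separately makes the probability a product, so the law of
    [q . r_i] is never computed. *)
Definition row_event (i : 'I_D) : set T := [set w | forall j, C j (g i j w)].

Definition row_prob : R := \prod_j gauss_shift 0 (C j).

Lemma gauss_shift0T : gauss_shift 0 [set: R] = 1.
Proof. by rewrite /gauss_shift preimage_setT probability_setT. Qed.

Lemma gauss_shift_le1 b (B : set R) : measurable B -> gauss_shift b B <= 1.
Proof.
move=> mB; rewrite -lee_fin gauss_shiftE//; apply: probability_le1.
exact: measurable_shift.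
Qed.

Lemma row_prob_le1 : row_prob <= 1.
Proof.
by apply: prodr_ile1 => j _; rewrite gauss_shift_ge0 gauss_shift_le1.
Qed.

Lemma measurable_row_event i : measurable (row_event i).
Proof.
have -> : row_event i = \bigcap_(j in [set: 'I_d]) (g i j @^-1` C j).
  by apply/seteqP; split => w h j => [_|]; exact: h.
apply: fin_bigcap_measurable; first exact: finite_finset.
by move=> j _; rewrite -[X in measurable X]setTI; exact: measurable_funP.
Qed.

Definition rows_event (L M : seq 'I_D) : set T :=
  [set w | (forall i, i \in L -> row_event i w) /\
           (forall i, i \in M -> ~ row_event i w)].

Lemma measurable_rows_event L M : measurable (rows_event L M).
Proof.
have -> : rows_event L M = (\bigcap_(i in [set` L]) row_event i) `&`
    (\bigcap_(i in [set` M]) ~` row_event i).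
  by apply/seteqP; split => w /=.
by apply: measurableI; apply: fin_bigcap_measurable => // i _;
  [|apply: measurableC]; exact: measurable_row_event.
Qed.

(** The failure of a row event is not a rectangle, so [probability_rect] does not apply directly. By
    induction on [M], requiring [k] to fail removes from [rows_event L M] the part where [k]
    succeeds. *)
Lemma probability_rows_event L M : uniq (L ++ M) ->
  P (rows_event L M) = (row_prob ^+ size L * (1 - row_prob) ^+ size M)%:E.
Proof.
elim: M L => [|k M IH] L.
  rewrite cats0 expr0 mulr1 => uL; have [ind gau] := iid.
  have gau' k : standard_normal (gg k) by exact: gau.
  pose B (k : K) := if k.1 \in L then C k.2 else setT.
  have mB k : measurable (B k) by rewrite /B; case: ifP.
  have -> : rows_event L [::] = [set w | forall k, B k (gg k w)].
    apply/seteqP; split => w /=; rewrite /B.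
      by move=> [h _] [i j] /=; case: ifP => // iL; exact: h.
    by move=> h; split => // i iL j; have := h (i, j); rewrite /= iL.
  rewrite (probability_rect ind gau' mB); congr EFin.
  rewrite -(pair_bigA _ (fun i j => gauss_shift 0 (B (i, j))))/=.
  rewrite (bigID (mem L))/= [X in _ * X]big1 ?mulr1; last first.
    move=> i /negbTE iL; apply: big1 => j _; rewrite /B/= iL.
    exact: gauss_shift0T.
  rewrite (eq_bigr (fun=> row_prob)); last first.
    by move=> i iL; apply: eq_bigr => j _; rewrite /B/= iL.
  by rewrite prodr_const (card_uniqP uL).
move=> uLM.
have ukLM : uniq ((k :: L) ++ M).
  by move: uLM; rewrite -cat1s uniq_catCA.
have uLM' : uniq (L ++ M) by move: ukLM; rewrite cat_cons cons_uniq => /andP[].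
have -> : rows_event L (k :: M) = rows_event L M `\` rows_event (k :: L) M.
  apply/seteqP; split => w /=.
    move=> [hL hM]; split.
      by split => // i iM; apply: hM; rewrite inE iM orbT.
    move=> [h _]; apply: (hM k); first exact: mem_head.
    by apply: h; exact: mem_head.
  move=> [[hL hM] n]; split => // i; rewrite inE => /predU1P[->|]; last exact: hM.
  move=> kw; apply: n; split => // i'; rewrite inE => /predU1P[->//|]; exact: hL.
transitivity (P (rows_event L M) - P (rows_event (k :: L) M))%E; last first.
  by rewrite !IH// -EFinB/=; congr EFin; rewrite !exprS; ring.
rewrite measureD; [|exact: measurable_rows_event|exact: measurable_rows_event|].
  rewrite setIidr// => w [h1 h2]; split => // i iL.
  by apply: h1; rewrite inE iL orbT.
by rewrite -ge0_fin_numE// fin_num_measure//; exact: measurable_rows_event.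
Qed.

(** [N] is the event that one of [s0] disjoint blocks of at least [m] indices contains no success;
    for one block this has probability at most [(1 - row_prob) ^+ m]. Outside [N], one success per
    block gives [s0] distinct indices. *)
Lemma many_rows (s0 m : nat) (p : R) : (0 < m)%N -> (s0 * m <= D)%N ->
  0 <= p <= row_prob ->
  exists N : set T, [/\ measurable N,
    (P N <= (s0%:R * expR (- (p * m%:R)))%:E)%E &
    forall w, ~ N w -> forall A : pred 'I_D, (forall i, row_event i w -> A i) ->
      (s0 <= #|A|)%N].
Proof.
move=> m0 smD /andP[p0 pp].
pose blk (b : 'I_s0) : seq 'I_D :=
  [seq i : 'I_D <- enum 'I_D | (i %/ m == b)%N].
have size_blk b : (m <= size (blk b))%N.
  have lt (j : 'I_m) : (b * m + j < D)%N.
    apply: leq_trans smD; apply: (@leq_trans (b.+1 * m)%N).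
      by rewrite mulSnr ltn_add2l.
    by rewrite leq_mul2r (ltn_ord b) orbT.
  rewrite -[m in (m <= _)%N]size_enum_ord -(size_map (fun j => Ordinal (lt j))).
  apply: uniq_leq_size.
    rewrite map_inj_uniq ?enum_uniq// => j j' /(congr1 val)/= /eqP.
    by rewrite eqn_add2l => /eqP/val_inj.
  move=> _ /mapP[j _ ->]; rewrite mem_filter mem_enum andbT /=.
  by rewrite divnMDl// divn_small ?addn0.
exists (\bigcup_(b in [set` enum 'I_s0]) rows_event [::] (blk b)).
split.
- by apply: fin_bigcup_measurable => // b _; exact: measurable_rows_event.
- apply: le_trans (union_bound _ _ _) _.
    by move=> b; exact: measurable_rows_event.
  rewrite big_enum/=.
  apply: (@le_trans _ _ (\sum_(b < s0) (expR (- (p * m%:R)))%:E)%E).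
    apply: lee_sum => b _.
    rewrite probability_rows_event; last exact/filter_uniq/enum_uniq.
    rewrite lee_fin /= expr0 mul1r.
    have q0 : 0 <= 1 - row_prob by rewrite subr_ge0 row_prob_le1.
    have q1 : 1 - row_prob <= 1.
      by rewrite gerBl; apply: prodr_ge0 => j _; exact: gauss_shift_ge0.
    apply: (@le_trans _ _ ((1 - row_prob) ^+ m)).
      by apply: ler_wiXn2l => //; rewrite q0.
    rewrite mulrC -mulrN expRM_natl ler_pXn2r ?nnegrE ?expR_ge0//.
    apply: le_trans (expR_ge1Dx _); lra.
  by rewrite sumEFin sumr_const card_ord mulr_natl.
move=> w Nw A hA.
have sel (b : 'I_s0) : exists i : 'I_D, A i && (i %/ m == b)%N.
  apply: contrapT => hN; apply: Nw.
  exists b; first by rewrite /= mem_enum.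
  split => // i; rewrite mem_filter => /andP[ib _] iw; apply: hN.
  by exists i; rewrite ib hA.
pose f b := xchoose (sel b).
have fA b : A (f b) by have /andP[] := xchooseP (sel b).
have fm b : (f b %/ m = b)%N by have /andP[_ /eqP] := xchooseP (sel b).
have finj : injective f.
  by move=> b b' e; apply: val_inj; rewrite /= -(fm b) e fm.
rewrite -[s0]card_ord -(card_imset _ finj); apply: subset_leq_card.
by apply/fintype.subsetP => _ /imsetP[b _ ->]; exact: fA.
Qed.

End ManyLargeProjections.

(** * Choice of the threshold *)

(** Since [n ^ (1 / c) = exp (2 a^2 / 3)] outweighs the factor [exp (- a^2 / 2)] in [p], the product
    [p * m] is at least a multiple of [exp a], hence at least [2 ln n], which is only of order
    [a^2]. *)
Lemma gaussian_thresholds (R : realType) (d s0 h : nat) (c : R) :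
  (0 < s0)%N -> 1 < c ->
  exists N : nat, forall n : nat, (N <= n)%N ->
  forall D : nat, `|D%:R - n%:R `^ c^-1| < 1 ->
  let a : R := Num.sqrt (3 / 2 * ln n%:R / c) in
  let m := (D %/ s0)%N in
  let p : R := normal_peak (1 : R) ^+ d *
    expR (- (a ^+ 2 + 2 * a * d%:R + d%:R) / 2) in
  [/\ (0 < n)%N, 0 < a /\ a ^+ 2 * c = 3 / 2 * ln n%:R, (0 < m)%N,
      s0%:R * expR (- (p * m%:R)) <= n%:R^-1 / 4 &
      h%:R * expR (- (5 / 4 * ln (n%:R : R))) <= n%:R^-1 / 2].
Proof.
move=> s00 c1.
have s0R : 1 <= s0%:R :> R by rewrite ler1n.
have c0 : 0 < c by lra.
pose k : R := normal_peak (1 : R) ^+ d / (2 * s0%:R).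
have k0 : 0 < k.
  by rewrite divr_gt0 ?exprn_gt0 ?normal_peak_gt0 ?oner_neq0// mulr_gt0// ltr0n.
(* The first term gives [a^2 / 6 - a d - d / 2 >= a], the second [k (a / 3)^3 >= 2 L]. *)
pose A0 : R := 6 * (d%:R + 2) + 36 * c / k.
have A00 : 0 <= 36 * c / k by rewrite divr_ge0 ?(ltW k0)//; lra.
have d0 : 0 <= d%:R :> R by [].
have h0 : 0 <= h%:R :> R by [].
(* In order, the summands serve [A0 <= a], the bound with [h], the bound with [s0], and the lower
   bound [mM] on [m]. *)
pose L0 : R := c * A0 ^+ 2 + 8 * h%:R + 4 * s0%:R + c * (2 + 2 * s0%:R).
exists (Num.trunc (expR L0)).+1 => n Nn D Dn a m p.
have n1 : expR L0 <= n%:R.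
  by apply: ltW; apply: lt_le_trans (truncnS_gt _) _; rewrite ler_nat.
have n0 : 0 < n%:R :> R by apply: lt_le_trans n1; exact: expR_gt0.
set L := ln n%:R : R.
have nL : n%:R = expR L :> R by rewrite /L lnK// posrE.
have LL : L0 <= L by rewrite -ler_expR -nL.
have cA : 0 <= c * A0 ^+ 2 by rewrite mulr_ge0 ?sqr_ge0// ltW.
have cs : 0 <= c * (2 + 2 * s0%:R) by rewrite mulr_ge0; lra.
have Lh : 8 * h%:R <= L by rewrite /L0 in LL; lra.
have Ls : 4 * s0%:R <= L by rewrite /L0 in LL; lra.
have LA : A0 ^+ 2 <= L / c by rewrite ler_pdivlMr// mulrC; rewrite /L0 in LL; lra.
have LM : 2 + 2 * s0%:R <= L / c.
  by rewrite ler_pdivlMr// mulrC; rewrite /L0 in LL; lra.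
have L0p : 0 < L by lra.
have a2 : a ^+ 2 = 3 / 2 * (L / c).
  rewrite sqr_sqrtr -/L ?mulrA// divr_ge0 ?(ltW c0)//; lra.
have A0a : A0 <= a.
  rewrite -(ler_pXn2r (n := 2))// ?nnegrE ?sqrtr_ge0//; last by rewrite /A0; lra.
  by rewrite a2; lra.
have a12 : 6 * (d%:R + 2) <= a by rewrite /A0 in A0a; lra.
have ack : 36 * c / k <= a by rewrite /A0 in A0a; lra.
have a0 : 0 < a by lra.
have nN : (0 < n)%N by rewrite -(ltr_nat R).
have sN : L / c = 2 / 3 * a ^+ 2 by rewrite a2; lra.
have Mexp : n%:R `^ c^-1 = expR (L / c).
  by rewrite /powR gt_eqF// -/L mulrC.
have Mge : 1 + L / c <= expR (L / c) by exact: expR_ge1Dx.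
have DM : expR (L / c) - 1 <= D%:R.
  by move: Dn; rewrite Mexp ltr_norml => /andP[]; lra.
have mD : D%:R <= s0%:R * (m%:R + 1) :> R.
  by rewrite natr1 -natrM ler_nat mulnC ltnW// ltn_ceil.
(* Rounding [D] and dividing by [s0] lose at most [1 + s0] from [s0 * m], which is at most half of
   [expR (L / c)]. *)
have mM : expR (L / c) <= 2 * s0%:R * m%:R by nra.
have m0 : (0 < m)%N.
  rewrite lt0n; apply/eqP => m0; move: mM; rewrite m0 mulr0; lra.
have pm : 2 * L <= p * m%:R.
  have : k * expR a <= p * m%:R.
    apply: (@le_trans _ _ (k *
      (expR (- (a ^+ 2 + 2 * a * d%:R + d%:R) / 2) * expR (L / c)))).
      rewrite ler_pM2l// -expRD ler_expR sN; nra.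
    rewrite (_ : k * _ = p * (expR (L / c) / (2 * s0%:R))); last first.
      by rewrite /k /p; ring.
    rewrite ler_wpM2l//.
      by rewrite mulr_ge0 ?expR_ge0// exprn_ge0// normal_peak_ge0.
    by rewrite ler_pdivrMr ?mulr_gt0 ?ltr0n// [leRHS]mulrC.
  apply: le_trans.
  (* A cubic lower bound suffices, as [L] is quadratic in [a]. *)
  have ea : (a / 3) ^+ 3 <= expR a.
    have -> : expR a = expR (a / 3) ^+ 3.
      by rewrite -expRM_natl; congr expR; field.
    rewrite ler_pXn2r// ?nnegrE ?expR_ge0//; last lra.
    by apply: le_trans (expR_ge1Dx _); lra.
  apply: (@le_trans _ _ (k * (a / 3) ^+ 3)); last by rewrite ler_pM2l.
  have -> : L = 2 / 3 * a ^+ 2 * c by rewrite -sN divfK// gt_eqF.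
  have : 36 * c <= a * k by rewrite -ler_pdivrMr.
  have : 0 <= a ^+ 2 by exact: sqr_ge0.
  have -> : k * (a / 3) ^+ 3 = a ^+ 2 * (a * k) / 27 by field.
  nra.
split => //.
- by split=> //; rewrite a2; field; rewrite gt_eqF.
- apply: (@le_trans _ _ (s0%:R * expR (- (2 * L)))).
    by rewrite ler_wpM2l// ler_expR lerN2.
  rewrite nL -expRN ler_pdivlMr//.
  have -> : expR (- (2 * L)) = expR (- L) * expR (- L).
    by rewrite -expRD; congr expR; ring.
  have E1 : s0%:R * 4 * expR (- L) <= 1.
    by rewrite expRN ler_pdivrMr ?expR_gt0// mul1r; have := expR_ge1Dx L; lra.
  have := expR_gt0 (- L); move: (expR (- L)) E1 => E E1 E0.
  rewrite (_ : _ * 4 = s0%:R * 4 * E * E); last by ring.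
  by rewrite ger_pMl.
- have -> : - (5 / 4 * L) = - L + - (L / 4) by field.
  rewrite expRD nL -expRN mulrCA ler_wpM2l ?expR_ge0//.
  rewrite expRN ler_pdivrMr ?expR_gt0//.
  have := expR_ge1Dx (L / 4); lra.
Qed.

(** * Lower bound on the query component, and conclusion *)

Section LargeProjections.
Context {R : realType} {disp : measure_display} {T : measurableType disp}.
Variable P : probability T R.
Context {D d : nat}.
Variable g : 'I_D -> 'I_d -> {RV P >-> R}.
Hypothesis iid : iid_gaussian_vectors g.
Local Notation rv := (random_vectors g).

(** The squares of the [a |q_j| + 1] sum to at most [a^2 + 2 a d + d], because the [q_j^2] sum to 1
    and each [|q_j|] is at most 1. *)
Lemma row_prob_outer_itv (q : 'cV[R]_d) (a : R) : enorm q = 1 -> 0 <= a ->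
  normal_peak 1 ^+ d * expR (- (a ^+ 2 + 2 * a * d%:R + d%:R) / 2) <=
  row_prob (fun j => outer_itv (a * q j 0)).
Proof.
move=> q1 a0.
have qq := sum_sqr_unit q1.
apply: (@le_trans _ _ (\prod_j (normal_peak 1 *
    expR (- (`|a * q j 0| + 1) ^+ 2 / 2)))); last first.
  apply: ler_prod => j _; rewrite gauss_shift_outer_itv andbT.
  by rewrite mulr_ge0 ?normal_peak_ge0 ?expR_ge0.
rewrite big_split/= prodr_const card_ord ler_wpM2l ?exprn_ge0 ?normal_peak_ge0//.
rewrite -expR_sum ler_expR -mulr_suml sumrN ler_wpM2r// lerN2.
apply: (@le_trans _ _ (\sum_j (a ^+ 2 * q j 0 ^+ 2 + 2 * a + 1))); last first.
  by rewrite !big_split/= -mulr_sumr qq mulr1 !sumr_const card_ord mulr_natr.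
apply: ler_sum => j _.
have qj1 : `|q j 0| <= 1.
  rewrite -(ler_pXn2r (n := 2))// ?nnegrE// expr1n real_normK ?num_real// -qq.
  by rewrite (bigD1 j)//= lerDl sumr_ge0// => i _; exact: sqr_ge0.
rewrite normrM (ger0_norm a0) sqrrD1 exprMn real_normK ?num_real//.
by rewrite lerD2r lerD2l -mulr_natl mulrA -[leRHS]mulr1 ler_wpM2l// mulr_ge0.
Qed.

(** On a row event, [outer_itv_mul] gives [a q_j^2 <= q_j r_ij] for each [j]; summing over [j] gives
    [a <= q . r_i]. *)
Lemma many_large_projections (s0 : nat) (q : 'cV[R]_d) (a : R) :
  let m := (D %/ s0)%N in
  let p := normal_peak 1 ^+ d * expR (- (a ^+ 2 + 2 * a * d%:R + d%:R) / 2) in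
  enorm q = 1 -> 0 < a -> (0 < m)%N ->
  exists N : set T, [/\ measurable N,
    (P N <= (s0%:R * expR (- (p * m%:R)))%:E)%E &
    forall w, ~ N w -> (s0 <= #|[pred i | (a <= dot q (rv w i))%R]|)%N].
Proof.
move=> m p q1 a0 m0.
have p_le : 0 <= p <= row_prob (fun j => outer_itv (a * q j 0)).
  rewrite row_prob_outer_itv ?(ltW a0)// andbT.
  by rewrite mulr_ge0 ?expR_ge0// exprn_ge0// normal_peak_ge0.
have smD : (s0 * m <= D)%N by rewrite mulnC leq_trunc_div.
have [N [mN PN NA]] := many_rows iid
  (fun j => measurable_outer_itv (a * q j 0)) m0 smD p_le.
exists N; split => // w /NA; apply => i iw.
rewrite inE dot_random_vectors.
have qq := sum_sqr_unit q1.
rewrite -[leLHS]mulr1 -qq mulr_sumr; apply: ler_sum => j _.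
have := outer_itv_mul (iw j); rewrite exprMn expr2 -!mulrA.
by rewrite ler_pM2l.
Qed.

End LargeProjections.

(** Each top rank contributes at least [a]; each bottom rank has projection at most [- a], by the
    hypothesis on [- q]. *)
Lemma dot_ceos_dir_ge (R : realType) (D d s0 : nat) (q : 'cV[R]_d)
    (rv : 'I_D -> 'cV[R]_d) (a : R) : (s0 <= D)%N ->
  (s0 <= #|[pred i | (a <= dot q (rv i))%R]|)%N ->
  (s0 <= #|[pred i | (a <= dot (- q) (rv i))%R]|)%N ->
  2 * s0%:R * a <= dot q (ceos_dir s0 q rv).
Proof.
move=> s0D hp hm; rewrite dot_score_dir.
have -> : 2 * s0%:R * a = s0%:R * a - s0%:R * - a by ring.
apply: lerB.
  rewrite -[s0 in leLHS](card_top_ranks (fun i => dot q (rv i)) s0D) mulr_natl.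
  rewrite -sumr_const; apply: ler_sum => i it.
  exact: (top_ranks_ge hp it).
rewrite -[s0 in leRHS](card_bottom_ranks (fun i => dot q (rv i)) s0D) mulr_natl.
rewrite -sumr_const; apply: ler_sum => i it.
apply: (bottom_ranks_le (s0 := s0) (a := - a) _ it).
apply: leq_trans hm _; apply: subset_leq_card; apply/fintype.subsetP => j.
by rewrite !inE -scaleN1r dotZl mulN1r lerNr.
Qed.

(* The dimension is fixed while n grows: the threshold N depends on d, s0 and c
   only. D is n^(1/c) rounded to an integer, with either rounding allowed. *)
Theorem theorem4p1 (R : realType) (d s0 : nat) (c : R) :
  (0 < s0)%N -> 1 < c ->
  exists N : nat, forall n : nat, (N <= n)%N ->
  forall (X : {fset 'cV[R]_d}) (q x : 'cV[R]_d),
  #|` X|%fset = n ->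
  enorm q = 1 ->
  x \in X ->
  (forall z : 'cV[R]_d, z \in X -> dot z q <= dot x q) ->
  (forall y : 'cV[R]_d, y \in (X `\ x)%fset ->
    c / s0%:R < alpha q x y ^+ 2) ->
  forall D : nat, `|D%:R - n%:R `^ c^-1| < 1 ->
  forall (disp : measure_display) (T : measurableType disp)
    (P : probability T R) (g : 'I_D -> 'I_d -> {RV P >-> R}),
  iid_gaussian_vectors g ->
  ((1 - n%:R^-1)%:E <=
   P [set w | forall y : 'cV[R]_d, y \in (X `\ x)%fset ->
        (ceos_score s0 (random_vectors g w) q y <=
         ceos_score s0 (random_vectors g w) q x)%R])%E.
Proof.
move=> s00 c1.
(* Then [(1 - eta) / (1 + eta) = 12 / 13], and [(12 / 13)^2 (3 / 2) >= 5 / 4] gives the exponent of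
   the net bound. *)
pose eta : R := 1 / 25.
have eta0 : 0 < eta by rewrite /eta; lra.
have [H [H_le H_net]] := @sphere_net R d eta eta0.
have [N HN] := gaussian_thresholds d (size H) s00 c1.
exists N => n Nn X q x _ q1 _ xmax xalpha D Dn disp T P g iid.
have /= := HN n Nn D Dn.
set a := Num.sqrt _; set m := (D %/ s0)%N; set p := normal_peak _ ^+ _ * _.
move=> [n0 [a0 a2] m0 tail1 tail2].
have s0R : 0 < s0%:R :> R by rewrite ltr0n.
have c0 : 0 < c by lra.
have s0D : (s0 <= D)%N.
  by apply: leq_trans (leq_trunc_div D s0); rewrite leq_pmull.
have Nq1 : enorm (- q) = 1.
  by rewrite /enorm -scaleN1r dotZl dotZr !mulN1r opprK; exact: q1.
have [N1 [mN1 PN1 hN1]] := many_large_projections iid q1 a0 m0.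
have [N2 [mN2 PN2 hN2]] := many_large_projections iid Nq1 a0 m0.
pose sc : R := Num.sqrt (c * s0%:R).
have sc0 : 0 < sc by rewrite sqrtr_gt0 mulr_gt0.
have sc2 : sc ^+ 2 = c * s0%:R by rewrite sqr_sqrtr// mulr_ge0// ltW.
(* This is [sqrt (c / s0)] times the lower bound [2 s0 a] on the query component. *)
pose tau : R := 2 * a * sc.
have tau0 : 0 < tau by rewrite !mulr_gt0.
have eta1 : 0 <= 1 - eta by rewrite /eta; lra.
(* Net points of the whole space are projected: [perp q h] is orthogonal to [q], no longer than [h],
   and its product with [v] is that of [h] with [perp q v]. *)
pose B3 h : set T := [set w | (1 - eta) * tau <=
  dot (perp q h) (ceos_dir s0 q (random_vectors g w))].
have mB3 h : measurable (B3 h).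
  apply: (@measurable_ceos_dir _ _ _ P _ _ g s0 q
    (fun v => (1 - eta) * tau <= dot (perp q h) v)) => A B.
  by apply: measurable_le_fun => //; exact: measurable_dot_score_dir.
pose N3 : set T := \bigcup_(h in [set` H]) B3 h.
have mN3 : measurable N3.
  by apply: fin_bigcup_measurable => //; exact: finite_set_seq.
have PN3 : (P N3 <= (n%:R^-1 / 2)%:E)%E.
  apply: le_trans (union_bound P H mB3) _.
  apply: (@le_trans _ _ (\sum_(h <- H) (expR (- (5 / 4 * ln n%:R)))%:E)%E).
    rewrite !big_seq; apply: lee_sum => h hH.
    apply: le_trans (ceos_dir_tail (rho := 1 + eta) s0D iid _ _ _ _ s00) _.
    - exact: dot_perp_q.
    - by rewrite addr_gt0.
    - by rewrite mulr_ge0// ltW.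
    - exact: le_trans (enorm_perp_le _ q1) (H_le h hH).
    rewrite lee_fin ler_expR lerN2.
    have -> : ((1 - eta) * tau) ^+ 2 / (4 * (1 + eta) ^+ 2 * s0%:R) =
        ((1 - eta) / (1 + eta)) ^+ 2 * (3 / 2 * ln n%:R).
      rewrite -a2 /tau !exprMn sc2; field.
      by rewrite !gt_eqF// addr_gt0.
    have ln0 : 0 <= ln n%:R :> R by apply: ln_ge0; rewrite ler1n.
    have -> : (1 - eta) / (1 + eta) = 12 / 13 by rewrite /eta; field.
    by rewrite mulrA ler_wpM2r//; lra.
  rewrite sumEFin big_const_seq count_predT iter_addr_0 lee_fin.
  by rewrite -[X in X <= _]mulr_natl.
(* The budget [1 / n] is split into a quarter for each of [q] and [- q], and a half for the net. *)
have PN : (P (N1 `|` N2 `|` N3) <= (n%:R^-1)%:E)%E.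
  apply: le_trans (measureU2 _ _ _) _ => //; first exact: measurableU.
  apply: (@le_trans _ _
    ((n%:R^-1 / 4)%:E + (n%:R^-1 / 4)%:E + (n%:R^-1 / 2)%:E)%E).
    apply: leeD => //; apply: le_trans (measureU2 _ _ _) _ => //.
    by apply: leeD; [apply: le_trans PN1 _|apply: le_trans PN2 _]; rewrite lee_fin.
  by rewrite -!EFinD lee_fin; lra.
set E := [set w | _].
have mE : measurable E.
  have -> : E = \bigcap_(y in [set` (X `\ x)%fset]) [set w |
      dot y (ceos_dir s0 q (random_vectors g w)) <=
      dot x (ceos_dir s0 q (random_vectors g w))].
    by apply/seteqP; split => w /= Ew y yX;
      have := Ew y yX; rewrite !ceos_scoreE.
  apply: fin_bigcap_measurable => [|y _]; first exact: finite_fset.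
  apply: (@measurable_ceos_dir _ _ _ P _ _ g s0 q
    (fun v => dot y v <= dot x v)) => A B.
  by apply: measurable_le_fun; exact: measurable_dot_score_dir.
have mN : measurable (N1 `|` N2 `|` N3) by do 2?apply: measurableU.
have NE : ~` (N1 `|` N2 `|` N3) `<=` E.
  move=> w /not_orP[/not_orP[w1 w2] w3] y yX; rewrite !ceos_scoreE//.
  set v := ceos_dir _ _ _.
  have G : 2 * s0%:R * a <= dot q v.
    by apply: dot_ceos_dir_ge => //; [exact: hN1|exact: hN2].
  have yx : dot y q <= dot x q.
    by apply: xmax; move: yX; rewrite !inE => /andP[].
  have kap0 : 0 < sc / s0%:R by rewrite divr_gt0.
  apply: (alpha_separation q1 kap0 yx).
    rewrite (_ : (sc / s0%:R) ^+ 2 = c / s0%:R); first exact: xalpha.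
    by rewrite exprMn sc2; field; rewrite gt_eqF.
  apply: (@le_trans _ _ tau); last first.
    rewrite (_ : tau = sc / s0%:R * (2 * s0%:R * a)); last first.
      by rewrite /tau; field; rewrite gt_eqF.
    by rewrite ler_pM2l.
  (* An orthogonal part longer than [tau] would be detected by some net point, putting [w] in
     [N3]. *)
  rewrite leNgt; apply/negP => tv; apply: w3.
  have [h hH hv] := H_net (perp q v) (lt_trans tau0 tv).
  exists h => //; rewrite /B3 /= dot_perpr// -/v.
  by apply: le_trans hv; rewrite ler_wpM2l// ltW.
apply: (@le_trans _ _ (P (~` (N1 `|` N2 `|` N3)))).
  by rewrite probability_setC// EFinB; apply: leeB.
by apply: le_measure; rewrite ?inE//; exact: measurableC.
Qed.
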